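(* Let $\mathfrak{n}>\mathfrak{m}\ge 2$ be integers and let $\Sigma\subseteq\Delta_{\mathfrak{m},\mathfrak{n}}^{\mathbb{N}}$ be a (nonempty) sofic subshift which is presented by a finite labelled directed graph $G$. Let $\{G_1,\ldots,G_k\}$ be the irreducible components of $G$. Then the box dimension of $\Pi(\Sigma)$ exists and $$\dim_{\mathrm{B}}\Pi(\Sigma)=\max_{1\le i\le k}\left\{\frac{h(\Sigma_{G_i})}{\log\mathfrak{n}}+\max_{j\in\{i\}^+}h(\pi\Sigma_{G_j})\left(\frac{1}{\log\mathfrak{m}}-\frac{1}{\log\mathfrak{n}}\right)\right\}.$$
   Context: Let $\mathfrak{n}>\mathfrak{m}\ge2$ be integers and $\Delta_{\mathfrak{m},\mathfrak{n}}=\{(a,b): 1\le a\le\mathfrak{m},\ 1\le b\le\mathfrak{n},\ a,b\in\mathbb{N}\}$. For $(a,b)\in\Delta_{\mathfrak{m},\mathfrak{n}}$ let $S_{(a,b)}:[0,1]^2\to[0,1]^2$, $S_{(a,b)}(x,y)=\left(\frac{x+a-1}{\mathfrak{m}},\frac{y+b-1}{\mathfrak{n}}\right)$. The coding map $\Pi:\Delta_{\mathfrak{m},\mathfrak{n}}^{\mathbb{N}}\to[0,1]^2$ is $\Pi((a_1,b_1)(a_2,b_2)\ldots)=\lim_{n\to\infty}S_{(a_1,b_1)}\circ\cdots\circ S_{(a_n,b_n)}(0)$. A subshift is a compact set $\Sigma$ of sequences over a finite alphabet (here a digit set $\mathcal{I}\subseteq\Delta_{\mathfrak{m},\mathfrak{n}}$)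 with $\sigma(\Sigma)\subseteq\Sigma$, where $\sigma$ is the left shift. $\Sigma_n$ denotes the set of words of length $n$ appearing in sequences of $\Sigma$, and the topological entropy is $h(\Sigma)=\lim_{n\to\infty}\frac1n\log\#\Sigma_n$. The projection $\pi$ is $\pi((a_1,b_1)(a_2,b_2)\ldots)=a_1a_2\ldots$; $\pi\Sigma$ is again a subshift. For bounded $E$, $N_\delta(E)$ is the smallest number of sets of diameter $\delta$ needed to cover $E$; $\underline{\dim}_{\mathrm{B}}E$ and $\overline{\dim}_{\mathrm{B}}E$ are the lower and upper limits as $\delta\to0$ of $\log N_\delta(E)/(-\log\delta)$, and $\dim_{\mathrm{B}}E$ is their common value when they coincide. A finite labelled directed graph $G$ (finite vertex set, finite edge set, each edge $e$ carrying a label $\ell(e)\in\mathcal{I}$) presents $\Sigma$ if $\Sigma$ is the set of all sequences $\ell(e_1)\ell(e_2)\ldots$ where $e_1e_2\ldots$ is an infinite path in $G$; $\Sigma$ is sofic if it is presented by such a graph. A graph is irreducible if for any pair of vertices $v,w$ there is a path from $v$ to $w$. The irreducible components $G_1,\ldots,G_k$ of $G$ are its maximal irreducible subgraphs. $\Sigma_{G_i}\subseteq\Sigma$ is the subshift of label sequences of infinite paths in $G_i$ (if $G_i$ is a single vertex without edges, its entropies are taken to be $0$). $\{i\}^+$ is the set of all $j\in\{1,\ldots,k\}$ such that there is a path in $G$ from a vertex of $G_i$ to a vertex of $G_j$; always $i\in\{i\}^+$. *)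

(* Defs.v *)
From HB Require Import structures.
From mathcomp Require Import all_boot all_order all_algebra.
From mathcomp Require Import all_classical all_reals all_analysis.
Import Order.TTheory GRing.Theory Num.Theory.
Import numFieldNormedType.Exports.

Set Implicit Arguments.
Unset Strict Implicit.
Unset Printing Implicit Defensive.

Local Open Scope classical_set_scope.
Local Open Scope ring_scope.

Section Shifts.
Variable A : finType.
Implicit Type X : set (nat -> A).

Definition left_shift (x : nat -> A) : nat -> A := fun k => x k.+1.

Definition subshift X : Prop :=
  @compact (prod_topology (fun _ : nat => discrete_topology A)) X /\
  left_shift @` X `<=` X.

Definition words X (n : nat) : {set n.-tuple A} :=
  [set w : n.-tuple A |
     `[< exists x i, X x /\ forall k : 'I_n, tnth w k = x (i + k)%N >]]%SET.

(* [ln 0 = 0] in the library, so [entropy R set0 = 0]: this is the convention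
   for an irreducible component without edges. *)
Definition entropy (R : realType) X : R :=
  limn (fun n => n%:R^-1 * ln #|words X n|%:R).

End Shifts.
Arguments entropy {A} R X.

(* Multiple edges and loops are allowed. *)
Record lgraph (A : Type) := LGraph {
  vertex : finType;
  edge : finType;
  source : edge -> vertex;
  target : edge -> vertex;
  label : edge -> A
}.

Section Graphs.
Variables (A : Type) (G : lgraph A).

Definition subgraph := ({set vertex G} * {set edge G})%type.
Implicit Types H K : subgraph.

Definition whole : subgraph := ([set: vertex G], [set: edge G])%SET.

Definition is_subgraph H : bool :=
  [forall e in H.2, (source e \in H.1) && (target e \in H.1)].

Definition step H : rel (vertex G) := fun v w =>
  [exists e in H.2, (source e == v) && (target e == w)].

(* [connect] is the reflexive transitive closure: the empty path is a path, so
   a single vertex without edges is irreducible. *)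
Definition irreducible H : bool :=
  [&& is_subgraph H, [exists v, v \in H.1]
    & [forall v in H.1, forall w in H.1, connect (step H) v w]].

Definition components : {set subgraph} :=
  [set H | irreducible H &&
     [forall K : subgraph,
        [&& irreducible K, H.1 \subset K.1 & H.2 \subset K.2] ==> (K == H)]]%SET.

(* The set {i}^+, for H = G_i. *)
Definition successors H : {set subgraph} :=
  [set K in components |
     [exists v in H.1, [exists w in K.1, connect (step whole) v w]]]%SET.

Definition path_labels H : set (nat -> A) :=
  [set x | exists e : nat -> edge G,
     [/\ forall k, e k \in H.2,
         forall k, target (e k) = source (e k.+1)
       & forall k, x k = label (e k)]].

Definition presents (X : set (nat -> A)) : Prop := X = path_labels whole.

End Graphs.

Section BoxDimension.
Variable R : realType.
Implicit Types (p q : R * R) (E U : set (R * R)) (delta : R).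

(* The library norm on [R * R] is the sup norm. *)
Definition euclid_dist p q : R := Num.sqrt ((p.1 - q.1) ^+ 2 + (p.2 - q.2) ^+ 2).

Definition diam U : \bar R :=
  ereal_sup [set (euclid_dist p q)%:E | p in U & q in U].

Definition coverable E delta (k : nat) : Prop :=
  exists U : 'I_k -> set (R * R),
    (forall i, diam (U i) = delta%:E) /\ E `<=` \bigcup_i U i.

(* The default value 0 only matters when no finite cover exists, in particular
   not when E is bounded and delta > 0. *)
Definition covering_number E delta : nat :=
  xget 0%N [set k | coverable E delta k /\
                    forall j, coverable E delta j -> (k <= j)%N].

Definition box_ratio E delta : \bar R :=
  (ln (covering_number E delta)%:R / - ln delta)%:E.

Definition lower_box_dim E : \bar R := limf_einf (box_ratio E) 0^'+.
Definition upper_box_dim E : \bar R := limf_esup (box_ratio E) 0^'+.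

Definition has_box_dim E (d : R) : Prop :=
  lower_box_dim E = d%:E /\ upper_box_dim E = d%:E.

End BoxDimension.

(* Digits are numbered from 0: [(a, b) : digit m n] stands for the pair
   (a + 1, b + 1) of Delta_{m,n}. *)
Definition digit (m n : nat) : finType := ('I_m * 'I_n)%type.

(* The library does not declare this join, which [limn] on [R * R] needs. *)
HB.instance Definition _ (T T' : ptopologicalType) := Pointed.on (T * T')%type.

Section Coding.
Variables (R : realType) (m n : nat).

Definition S_map (d : digit m n) (p : R * R) : R * R :=
  ((p.1 + d.1%:R) / m%:R, (p.2 + d.2%:R) / n%:R).

Definition coding (x : nat -> digit m n) : R * R :=
  limn (fun k => foldr S_map (0, 0) (mkseq x k)).

Definition row_seq (x : nat -> digit m n) : nat -> 'I_m := fun k => (x k).1.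

End Coding.
Arguments coding R {m n} x.

(* Main.v *)
Require Import Defs.
From mathcomp Require Import all_boot all_order all_algebra.
From mathcomp Require Import all_classical all_reals all_analysis.
From mathcomp Require Import zify ring lra.
Import Order.TTheory GRing.Theory Num.Theory.
Import numFieldNormedType.Exports.
Local Open Scope classical_set_scope.
Local Open Scope ring_scope.

(** A point of the coded set is [(0.a_1 a_2 ..., 0.b_1 b_2 ...)] in bases [m]
    and [n]. Take [l] with [m ^ l <= n ^ k < m ^ (l + 1)], so that [l] is
    about [k * ln n / ln m]. The rectangle of points with prescribed digits
    [a_1, ..., a_l] and [b_1, ..., b_k] is then, up to a constant, a square
    of side [n ^ - k]; a set of diameter less than [n ^ - k] meets at most
    25 of these rectangles, and each of them fits in one set of diameter a
    constant times [n ^ - k]. So the covering number at scale [n ^ - k] is,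
    up to constants and a bounded shift of [k], the number [square_count k]
    of rectangles whose digits begin some sequence of the shift
    ([has_box_dim_square_count]).

    Such a rectangle records the first [k] full digits of a sequence and the
    next [l - k] row digits. If [v] is the vertex at time [k] of a path that
    presents the sequence, the first part is a word read along a path into
    [v] and the second a row word read along a path out of [v]. Hence
    [square_count k] is at most the sum over [v] of the products of the two
    word counts ([square_count_le_paths]).

    The number of words of length [j] read from a vertex grows like [exp (j h)],
    up to subexponential factors, where [h] is the largest entropy of a
    component reachable from it: a path crosses the components one after the
    other, so its words are counted by convolutions of the word counts of
    the components, and convolutions do not raise the exponential rate
    beyond the largest one ([grows_runs_from]). Each component contributes
    its entropy by Fekete's lemma. Reversing all edges gives the words read
    into [v], relabelling the edges the row words. The product at [v] thus
    has exponent [k * h(G_i) + (l - k) * h(pi G_j)] for some component [G_i]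
    leading to [v] and some [G_j] reached from [v], and these satisfy that
    [j] is in [{i}^+] ([grows_vertex]).

    For the lower bound, given such a pair, words of [G_i] ending at a fixed
    vertex are joined by a fixed transit path to row words of [G_j] starting
    at a fixed vertex ([paths_le_square_count]). Fixing the vertices costs a
    constant factor only ([runs_from_lower]). Dividing the exponent by [k *
    ln n] gives the term of the pair in the two maxima. *)

Set Implicit Arguments.
Unset Strict Implicit.
Unset Printing Implicit Defensive.

(** * Counting words *)

Local Open Scope nat_scope.

Lemma leq_card_inj (T T' : finType) (f : T -> T') (P : pred T) (Q : pred T') :
  {in P &, injective f} -> (forall x, P x -> Q (f x)) -> #|P| <= #|Q|.
Proof.
move=> inj_f PQ; rewrite -(card_in_image inj_f).
apply: subset_leq_card; apply/fintype.subsetP => y /fintype.imageP[x Px ->].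
exact: PQ.
Qed.

Lemma leq_card_cover (T I : finType) (P : pred T) (Q : I -> pred T) :
  (forall x, P x -> exists i, Q i x) -> #|P| <= \sum_i #|Q i|.
Proof.
move=> PQ; under eq_bigr => i _ do rewrite -sum1_card.
rewrite -sum1_card (exchange_big_dep xpredT) //= big_mkcond /=.
apply: leq_sum => x _; rewrite /in_mem /=; case: ifP => // /PQ[i Qix].
by rewrite (bigD1 i).
Qed.

Section WordCount.
Variable L : finType.
Implicit Types (P Q : pred (seq L)) (k : nat).

Definition wcount P k : nat := #|[pred w : k.-tuple L | P w]|.

Lemma leq_wcount P Q k :
  (forall w, size w = k -> P w -> Q w) -> wcount P k <= wcount Q k.
Proof.
move=> PQ; apply: (@leq_card_inj _ _ id) => // w.
by apply: PQ; rewrite size_tuple.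
Qed.

Lemma wcount_gt0 P k w : size w = k -> P w -> 0 < wcount P k.
Proof.
move=> sw Pw; apply/card_gt0P; have sw' : size w == k by apply/eqP.
by exists (Tuple sw').
Qed.

Lemma wcount_cover (I : finType) P (Q : I -> pred (seq L)) k :
  (forall w, size w = k -> P w -> exists i, Q i w) ->
  wcount P k <= \sum_i wcount (Q i) k.
Proof.
move=> PQ; apply: leq_card_cover => w; apply: PQ; exact: size_tuple.
Qed.

(** The cast replaces the length [minn j k] of [take j w] by [j]. *)
Definition wtake j k (jk : j <= k) (w : k.-tuple L) : j.-tuple L :=
  tcast (minn_idPl jk) [tuple of take j w].

Lemma wtakeE j k (jk : j <= k) (w : k.-tuple L) : wtake jk w = take j w :> seq L.
Proof. by rewrite /wtake val_tcast. Qed.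

(** A word whose letter at position [j] is prescribed is determined by what
    precedes and what follows that letter. *)
Lemma wcount_split P Q1 Q2 j k a : j < k ->
  (forall w, size w = k -> P w ->
     [/\ Q1 (take j w), nth a w j = a & Q2 (drop j.+1 w)]) ->
  wcount P k <= wcount Q1 j * wcount Q2 (k - j.+1).
Proof.
move=> jk PQ; rewrite /wcount -cardX.
pose f (w : k.-tuple L) := (wtake (ltnW jk) w, [tuple of drop j.+1 w]).
apply: (@leq_card_inj _ _ f) => [w w'|w Pw]; last first.
  by rewrite !inE /= wtakeE; have [] := PQ w (size_tuple w) Pw => -> _ ->.
rewrite !inE => /PQ; rewrite size_tuple => /(_ erefl)[_ wj _].
move=> /PQ; rewrite size_tuple => /(_ erefl)[_ w'j _].
case=> /(congr1 val) /=; rewrite !wtakeE => tE dE; apply: val_inj => /=.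
rewrite -(cat_take_drop j w) -(cat_take_drop j w').
have jw (z : k.-tuple L) : j < size z by rewrite size_tuple.
by rewrite tE (drop_nth a (jw w)) (drop_nth a (jw w')) dE wj w'j.
Qed.

Lemma wcount_cat P Q1 Q2 i j :
  (forall w, size w = i + j -> P w -> Q1 (take i w) /\ Q2 (drop i w)) ->
  wcount P (i + j) <= wcount Q1 i * wcount Q2 j.
Proof.
move=> PQ; rewrite /wcount -cardX.
have ei := leq_addr j i; have ej : i + j - i = j by lia.
pose f (w : (i + j).-tuple L) := (wtake ei w, tcast ej [tuple of drop i w]).
apply: (@leq_card_inj _ _ f) => [w w' _ _|w Pw].
  case=> /(congr1 val) /=; rewrite !wtakeE => tE /(congr1 val) /=.
  rewrite !val_tcast /= => dE; apply: val_inj => /=.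
  by rewrite -(cat_take_drop i w) -(cat_take_drop i w') tE dE.
by rewrite !inE /= wtakeE val_tcast; have [] := PQ w (size_tuple w) Pw => -> ->.
Qed.

Lemma wcount_or P Q k :
  wcount (fun w => P w || Q w) k <= wcount P k + wcount Q k.
Proof.
rewrite /wcount -[X in _ <= X]cardUI; apply: leq_trans (leq_addr _ _).
by apply: subset_leq_card; apply/fintype.subsetP => w; rewrite !inE.
Qed.

Lemma wcount_rev P k : wcount (fun w => P (rev w)) k = wcount P k.
Proof.
apply/eqP; rewrite eqn_leq; apply/andP; split.
- apply: (@leq_card_inj _ _ (fun w : k.-tuple L => [tuple of rev w])) => //.
  move=> w w' _ _ /(congr1 val) /= /(congr1 rev); rewrite !revK.
  by move/val_inj.
- apply: (@leq_card_inj _ _ (fun w : k.-tuple L => [tuple of rev w])).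
    move=> w w' _ _ /(congr1 val) /= /(congr1 rev); rewrite !revK.
    by move/val_inj.
  by move=> w; rewrite !inE /= revK.
Qed.

End WordCount.

(** * Words read along paths *)

Section Runs.
Variables (L : finType) (G : lgraph L).
Implicit Types (D : {set edge G}) (v u x : vertex G) (w : seq L).

(** That some path from [v] to [u] with edges in [D] reads [w]. Recursion on the
    word, with no explicit path, keeps the predicate boolean, so that the words
    satisfying it can be counted. *)
Fixpoint run D v w u : bool :=
  if w is a :: w' then
    [exists e in D, [&& source e == v, label e == a & run D (target e) w' u]]
  else v == u.

Definition runs_from D v w := [exists u, run D v w u].

Lemma run_cons D v a w u :
  reflect (exists e, [/\ e \in D, source e = v, label e = a &
                         run D (target e) w u]) (run D v (a :: w) u).
Proof.
apply: (iffP exists_inP) => [[e De /and3P[/eqP ? /eqP ? ?]]|[e [? <- <- ?]]].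
  by exists e.
by exists e => //; apply/and3P.
Qed.

Lemma run_cat D v w1 w2 u :
  reflect (exists2 x, run D v w1 x & run D x w2 u) (run D v (w1 ++ w2) u).
Proof.
apply: (iffP idP).
  elim: w1 v => [|a w1 IH] v /= rw; first by exists v.
  have /run_cons[e [De sv la /IH[x r1 r2]]] := rw.
  by exists x => //; apply/run_cons; exists e.
elim: w1 v => [|a w1 IH] v /= [x]; first by move/eqP->.
move=> /run_cons[e [De sv la r1]] r2; apply/run_cons; exists e; split => //.
by apply: IH; exists x.
Qed.

Lemma runs_from_cat D v w1 w2 u :
  run D v w1 u -> runs_from D u w2 -> runs_from D v (w1 ++ w2).
Proof. by move=> r1 /existsP[y r2]; apply/existsP; exists y; apply/run_cat; exists u. Qed.

Lemma run_sub D D' v w u : D \subset D' -> run D v w u -> run D' v w u.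
Proof.
move=> /fintype.subsetP DD'; elim: w v => //= a w IH v /run_cons[e [De sv la /IH r]].
by apply/run_cons; exists e; split => //; exact: DD'.
Qed.

Lemma stepP (H : subgraph G) v u :
  reflect (exists e, [/\ e \in H.2, source e = v & target e = u]) (step H v u).
Proof.
apply: (iffP exists_inP) => [[e De /andP[/eqP ? /eqP ?]]|[e [? <- <-]]].
  by exists e.
by exists e => //; rewrite !eqxx.
Qed.

Lemma connect_run (H : subgraph G) v u :
  connect (step H) v u -> exists2 w, run H.2 v w u & size w <= #|vertex G|.
Proof.
case/connectP => p pth ->; case/shortenP: pth => q pth uq _.
have : size q <= #|vertex G|.
  by apply: leq_trans (leqnSn _) _; rewrite -[(size q).+1]/(size (v :: q)) -(card_uniqP uq) max_card.
suff [w r sw] : exists2 w, run H.2 v w (last v q) & size w = size q.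
  by move=> sq; exists w => //; rewrite sw.
elim: q v pth {uq} => [|y q IH] v /=; first by exists [::] => /=.
case/andP => /stepP[e [De <- te]] /IH[w r sw]; exists (label e :: w) => /=.
  by apply/run_cons; exists e; rewrite te.
by rewrite sw.
Qed.

Definition reaches v u := connect (step (whole G)) v u.

Lemma connect_reaches (H : subgraph G) v u : connect (step H) v u -> reaches v u.
Proof.
apply: connect_sub => x y /stepP[e [_ sx ty]].
by apply: connect1; apply/stepP; exists e; rewrite inE.
Qed.

Lemma edge_reaches (e : edge G) : reaches (source e) (target e).
Proof. by apply: connect1; apply/stepP; exists e; rewrite inE. Qed.

Definition scc v : {set vertex G} := [set u | reaches v u && reaches u v]%SET.

Definition scc_edges v : {set edge G} :=
  [set e | (source e \in scc v) && (target e \in scc v)]%SET.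

Definition scc_graph v : subgraph G := (scc v, scc_edges v).

Lemma scc_refl v : v \in scc v.
Proof. by rewrite inE /reaches connect0. Qed.

(** Every vertex of a path between two vertices of the component is itself
    mutually reachable with them, so the path uses only edges of the component. *)
Lemma scc_connect v x y : x \in scc v -> y \in scc v ->
  connect (step (scc_graph v)) x y.
Proof.
rewrite !inE => /andP[vx xv] /andP[vy yv].
have xy : reaches x y by exact: connect_trans vy.
case/connectP: xy vx vy yv => p pth -> {y}; elim: p x xv pth => [|z p IH] x xv //=.
case/andP => xz pth vx vy yv.
have [e [_ sx tz]] := stepP _ _ _ xz.
have zv : reaches z v.
  apply: connect_trans yv; apply/connectP; by exists p.
have vz : reaches v z by apply: connect_trans vx (connect1 xz).
apply: connect_trans (IH z zv pth vz vy yv).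
by apply: connect1; apply/stepP; exists e; split => //; rewrite !inE sx tz vx xv vz zv.
Qed.

Lemma is_subgraphP (H : subgraph G) e : is_subgraph H -> e \in H.2 ->
  source e \in H.1 /\ target e \in H.1.
Proof. by move=> /forall_inP /(_ e) sH /sH /andP. Qed.

Lemma irreducible_sub_scc (K : subgraph G) v : irreducible K -> v \in K.1 ->
  K.1 \subset scc v /\ K.2 \subset scc_edges v.
Proof.
case/and3P => sK _ /forall_inP cK vK.
have K1 u : u \in K.1 -> u \in scc v.
  move=> uK; rewrite inE; apply/andP; split; apply: (connect_reaches (H := K)).
    by have /forall_inP := cK v vK; apply.
  by have /forall_inP := cK u uK; apply.
split; apply/fintype.subsetP => // e eK; have [] := is_subgraphP sK eK.
by move=> /K1 se /K1 te; rewrite inE se.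
Qed.

Lemma irreducible_scc v : irreducible (scc_graph v).
Proof.
apply/and3P; split.
- by apply/forall_inP => e; rewrite inE.
- by apply/existsP; exists v; rewrite scc_refl.
- by apply/forall_inP => x xv; apply/forall_inP => y yv; exact: scc_connect.
Qed.

Lemma component_irreducible (H : subgraph G) : H \in components G -> irreducible H.
Proof. by rewrite inE => /andP[]. Qed.

(** Maximality holds because every irreducible graph through [v]
    lies inside [scc_graph v]. *)
Lemma scc_component v : scc_graph v \in components G.
Proof.
rewrite inE irreducible_scc /=; apply/forallP => K; apply/implyP => /and3P[iK s1 s2].
have vK : v \in K.1 by apply: (fintype.subsetP s1); rewrite scc_refl.
have [K1 K2] := irreducible_sub_scc iK vK.
case: K s1 s2 K1 K2 {iK vK} => K1 K2 /= s1 s2 s1' s2'.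
by apply/eqP; congr (_, _); apply/eqP; rewrite finset.eqEsubset ?s1 ?s2 ?s1' ?s2'.
Qed.

Lemma component_ne (H : subgraph G) : H \in components G -> exists v, v \in H.1.
Proof. by move=> /component_irreducible /and3P[_ /existsP]. Qed.

End Runs.

(** Cutting a path at the first edge that leaves the component of its start:
    induction on the word, as long as the path has not yet left. *)
Lemma run_scc_split (L : finType) (G : lgraph L) (v x y : vertex G) (w : seq L) :
  x \in scc v -> run [set: edge G]%SET x w y ->
  run (scc_edges v) x w y \/
  exists j (e : edge G), [/\ j < size w,
    (source e \in scc v) && (target e \notin scc v),
    run (scc_edges v) x (take j w) (source e),
    nth (label e) w j = label e & run [set: edge G]%SET (target e) (drop j.+1 w) y].
Proof.
elim: w x => [|a w IH] x xv /=; first by left.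
case/run_cons => e [_ sx la r].
have [tv|tv] := boolP (target e \in scc v); last first.
  by right; exists 0, e; rewrite sx xv tv take0 /= drop0; split; rewrite ?eqxx.
have ev : e \in scc_edges v by rewrite inE sx xv tv.
case: (IH _ tv r) => [r'|[j [e' [jw se' r' le' r'']]]].
  by left; apply/run_cons; exists e.
right; exists j.+1, e'; split => //=.
by apply/run_cons; exists e.
Qed.

Definition runs (L : finType) (G : lgraph L) (H : subgraph G) (w : seq L) :=
  [exists v in H.1, runs_from H.2 v w].

Definition has_edges (L : finType) (G : lgraph L) (H : subgraph G) :=
  [exists e, e \in H.2].

Section Irreducible.
Variables (L : finType) (G : lgraph L) (H : subgraph G).
Hypothesis iH : irreducible H.

Lemma run_in v w u : v \in H.1 -> run H.2 v w u -> u \in H.1.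
Proof.
elim: w v => [|a w IH] v vH /=; first by move/eqP <-.
case/run_cons => e [eH _ _ /IH]; apply; have /and3P[sH _ _] := iH.
by have [] := is_subgraphP sH eH.
Qed.

Lemma irreducible_connect v u : v \in H.1 -> u \in H.1 -> connect (step H) v u.
Proof. by have /and3P[_ _ /forall_inP cH] := iH => /cH /forall_inP; exact. Qed.

Hypothesis eH : has_edges H.

Lemma out_edge v : v \in H.1 -> exists2 e, e \in H.2 & source e = v.
Proof.
move=> vH; have [e0 e0H] := existsP eH; have /and3P[sH _ _] := iH.
have [s0 _] := is_subgraphP sH e0H.
have /connectP[[|y p] /=] := irreducible_connect vH s0; first by move=> _ <-; exists e0.
by move=> /andP[/stepP[e [? ? _]] _] _; exists e.
Qed.

Lemma run_prolong k v : v \in H.1 -> exists2 w, size w = k & runs_from H.2 v w.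
Proof.
elim: k v => [|k IH] v vH; first by exists [::] => //; apply/existsP; exists v => /=.
have [e eD sv] := out_edge vH; have /and3P[sH _ _] := iH.
have [_ tH] := is_subgraphP sH eD.
have [w sw /existsP[u r]] := IH _ tH; exists (label e :: w); first by rewrite /= sw.
by apply/existsP; exists u; apply/run_cons; exists e.
Qed.

(** From [v] every vertex of [H] is reached by a path of length at most
    [c = #|vertex G|], and every path can be prolonged. So each word read in [H]
    is a factor, starting at one of [c + 1] positions, of a word of length
    [k + c] read from [v]: a path [v -> x], then the given one, then padding. *)
Lemma wcount_runs_le v k : v \in H.1 ->
  wcount (runs H) k <=
    #|vertex G|.+1 * wcount (runs_from H.2 v) (k + #|vertex G|).
Proof.
move=> vH; set c := #|_|.
pose Q (t : 'I_c.+1) (w : k.-tuple L) :=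
  [exists z : (k + c).-tuple L, runs_from H.2 v z && (take k (drop t z) == w)].
have -> : c.+1 * wcount (runs_from H.2 v) (k + c) =
          \sum_(t < c.+1) wcount (runs_from H.2 v) (k + c).
  by rewrite sum_nat_const card_ord.
apply: (@leq_trans (\sum_t #|Q t|)).
  apply: leq_card_cover => w /exists_inP[x xH /existsP[u r]].
  have [p rp sp] := connect_run (irreducible_connect vH xH).
  have uH := run_in xH r.
  have [q sq rq] := run_prolong (c - size p) uH.
  have sp' : size p < c.+1 by [].
  exists (Ordinal sp'); apply/existsP => /=.
  have sz : size (p ++ w ++ q) == k + c.
    by rewrite !size_cat size_tuple sq; apply/eqP; move: sp; rewrite -/c; lia.
  exists (Tuple sz) => /=; apply/andP; split.
    apply: runs_from_cat rp _; exact: runs_from_cat r rq.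
  by rewrite drop_size_cat // take_size_cat // size_tuple.
apply: leq_sum => t _; rewrite /wcount.
have [z0 _|Z0] := pickP [pred z : (k + c).-tuple L | runs_from H.2 v z]; last first.
  rewrite [X in _ <= X]eq_card0 ?leqn0; last by move=> z; exact: Z0.
  apply/eqP/eq_card0 => w; apply/negbTE/negP => /existsP[z /andP[rz _]].
  by have := Z0 z; rewrite /= rz.
(* [f] sends a word to a longer one of which it is the factor at [t]. *)
pose f (w : k.-tuple L) : (k + c).-tuple L :=
  odflt z0 [pick z : (k + c).-tuple L | runs_from H.2 v z & take k (drop t z) == w].
have fP w : Q t w -> runs_from H.2 v (f w) /\ take k (drop t (f w)) = w.
  move=> /existsP[z Pz]; rewrite /f; case: pickP => [y /andP[? /eqP ?]//|/(_ z)].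
  by rewrite Pz.
apply: (leq_card_inj (f := f)) => [w w' /fP[_ e1] /fP[_ e2] ff|w /fP[]//].
by apply: val_inj; rewrite /= -e1 -e2 ff.
Qed.

End Irreducible.

Lemma wcount_runs_edgeless (L : finType) (G : lgraph L) (H : subgraph G) k :
  ~~ has_edges H -> wcount (runs H) k <= 1.
Proof.
move=> nH; have H0 e : (e \in H.2) = false.
  by apply: contraNF nH => eH; apply/existsP; exists e.
case: k => [|k].
  by apply: leq_trans (max_card _) _; rewrite card_tuple expn0.
rewrite /wcount eq_card0 // => w; apply/negbTE/negP => /exists_inP[v _ /existsP[u]].
by case: w => -[|a w] //= sw /run_cons[e []]; rewrite H0.
Qed.

(** * Reversing and relabelling the edges *)

Definition revg (L : Type) (G : lgraph L) : lgraph L :=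
  LGraph (@target _ G) (@source _ G) (@label _ G).

Section Reversal.
Variables (L : finType) (G : lgraph L).
Implicit Types (D : {set edge G}) (v u : vertex G).

Lemma run_revg D v w u :
  run (G := revg G) D u (rev w) v = run D v w u.
Proof.
apply/idP/idP.
  elim: w v => [|a w IH] v /=; first by rewrite eq_sym.
  rewrite rev_cons -cats1 => /run_cat[x /IH r /run_cons[e [De /= tx la /eqP sv]]].
  by apply/run_cons; exists e; rewrite tx.
elim: w v => [|a w IH] v /=; first by rewrite eq_sym.
case/run_cons => e [De sv la r]; rewrite rev_cons -cats1; apply/run_cat.
exists (target e); first exact: IH.
by apply/run_cons; exists e; split => //=; rewrite sv.
Qed.

Lemma step_revg (H : subgraph G) v u :
  step (G := revg G) H v u = step H u v.
Proof.
by apply/stepP/stepP => -[e [? ? ?]]; exists e.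
Qed.

Lemma connect_revg (H : subgraph G) v u :
  connect (step (G := revg G) H) v u = connect (step H) u v.
Proof.
rewrite -[RHS]/([rel x y | connect (step H) y x] v u) connect_rev.
by apply: eq_connect => x y; exact: step_revg.
Qed.

Lemma reaches_revg v u : reaches (G := revg G) v u = reaches u v.
Proof. exact: connect_revg. Qed.

Lemma scc_graph_revg v : scc_graph (G := revg G) v = scc_graph (G := G) v.
Proof.
have sE : scc (G := revg G) v = scc (G := G) v.
  by apply/setP => u; rewrite !inE !reaches_revg andbC.
rewrite /scc_graph /scc_edges sE; congr (_, _); apply/setP => e.
by rewrite [LHS]finset.in_set [RHS]finset.in_set andbC.
Qed.

Lemma irreducible_revg (H : subgraph G) :
  irreducible H -> irreducible (G := revg G) H.
Proof.
case/and3P => sH nH /forall_inP cH; apply/and3P; split => //.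
  by apply/forall_inP => e eH; have [-> ->] := is_subgraphP sH eH.
apply/forall_inP => v vH; apply/forall_inP => u uH; rewrite connect_revg.
by have /forall_inP := cH u uH; exact.
Qed.

Lemma runs_revg_sub (H : subgraph G) (w : seq L) : irreducible H ->
  runs H w -> runs (G := revg G) H (rev w).
Proof.
move=> iH /exists_inP[v vH /existsP[u r]]; apply/exists_inP; exists u.
  exact: run_in r.
by apply/existsP; exists v; rewrite run_revg.
Qed.

End Reversal.

Lemma wcount_runs_revg (L : finType) (G : lgraph L) (H : subgraph G) k :
  irreducible H -> wcount (runs (G := revg G) H) k = wcount (runs H) k.
Proof.
move=> iH; apply/eqP; rewrite eqn_leq -{1}(wcount_rev (runs H)) -{2}wcount_rev.
apply/andP; split; apply: leq_wcount => w _; last exact: runs_revg_sub.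
exact: (runs_revg_sub (irreducible_revg iH)).
Qed.

Definition relabel (L L' : Type) (f : L -> L') (G : lgraph L) : lgraph L' :=
  LGraph (@source _ G) (@target _ G) (fun e => f (label e)).

Section Relabelling.
Variables (L L' : finType) (f : L -> L') (G : lgraph L).

Lemma run_relabel (D : {set edge G}) v w u :
  run D v w u -> run (G := relabel f G) D v (map f w) u.
Proof.
elim: w v => [//|a w IH] v /run_cons[e [De sv <- /IH r]].
by rewrite map_cons; apply/run_cons; exists e.
Qed.

Lemma relabel_run (D : {set edge G}) v y u :
  run (G := relabel f G) D v y u -> exists2 w, run D v w u & map f w = y.
Proof.
elim: y v => [|b y IH] v; first by move/eqP ->; exists [::] => /=.
case/(run_cons (G := relabel f G)) => e [De sv <- /IH[w r <-]].
exists (@label _ G e :: w) => //.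
by apply/(run_cons (G := G)); exists e.
Qed.

End Relabelling.

(** * Infinite paths *)

Section InfinitePaths.
Variables (L : finType) (G : lgraph L).
Implicit Types (H K : subgraph G) (v u : vertex G) (x z : nat -> L).

Definition labels_from H v : set (nat -> L) :=
  [set x | exists e : nat -> edge G,
     [/\ forall k, e k \in H.2, forall k, target (e k) = source (e k.+1),
         forall k, x k = label (e k) & source (e 0) = v]].

Lemma path_run (D : {set edge G}) (e : nat -> edge G) i k :
  (forall k, e k \in D) -> (forall k, target (e k) = source (e k.+1)) ->
  run D (source (e i)) (mkseq (fun j => label (e (i + j))) k) (source (e (i + k))).
Proof.
move=> De te; elim: k => [|k IH]; first by rewrite addn0 /=.
rewrite mkseqS -cats1; apply/run_cat; exists (source (e (i + k))) => //.
by apply/run_cons; exists (e (i + k)); split => //=; rewrite addnS te.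
Qed.

Lemma labels_from_cat H v w u x : run H.2 v w u -> labels_from H u x ->
  exists z, [/\ labels_from H v z, mkseq z (size w) = w
              & forall i, z (size w + i) = x i].
Proof.
elim: w v => [|a w IH] v /=; first by move/eqP <- => ?; exists x.
case/run_cons => e0 [De sv la /IH] {}IH /IH[z [[e [eD te ze se] zw zx]]].
exists (fun i => if i is i'.+1 then z i' else a); split => //.
  exists (fun i => if i is i'.+1 then e i' else e0); split => //; case=> //=.
rewrite /mkseq /= -[in RHS]zw; congr (_ :: _).
by rewrite (iotaDl 1 0) -map_comp.
Qed.

Lemma labels_from_sub H K v x : H.2 \subset K.2 ->
  labels_from H v x -> labels_from K v x.
Proof.
move=> /fintype.subsetP HK [e [eD te xe se]]; exists e; split=> // k; exact: HK.
Qed.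

Lemma labels_fromE H v : labels_from H v `<=` path_labels H.
Proof. by move=> x [e [? ? ? _]]; exists e. Qed.

Lemma infinite_path H v : irreducible H -> has_edges H -> v \in H.1 ->
  exists x, labels_from H v x.
Proof.
move=> iH eH vH; have [e0 _] := existsP eH.
pose g u := odflt e0 [pick e in H.2 | source e == u].
have gP u : u \in H.1 -> g u \in H.2 /\ source (g u) = u.
  move=> uH; rewrite /g; case: pickP => [e /andP[? /eqP ?]//|].
  by have [e eH' su] := out_edge iH eH uH => /(_ e); rewrite eH' su eqxx.
pose e k := g (iter k (fun u => target (g u)) v).
have vkH k : iter k (fun u => target (g u)) v \in H.1.
  elim: k => //= k /gP[gk _]; have /and3P[sH _ _] := iH.
  by have [] := is_subgraphP sH gk.
exists (fun k => label (e k)); exists e; split => //.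
- by move=> k; have [] := gP _ (vkH k).
- by move=> k; rewrite /e; have [_ ->] := gP _ (vkH k.+1).
- by have [_ ->] := gP _ (vkH 0).
Qed.

(** Words of the shift may occur anywhere in a sequence, but an irreducible
    graph with an edge lets every finite path be prolonged for ever, so they are
    the words read along finite paths. *)
Lemma card_words H k : irreducible H -> has_edges H ->
  #|words (path_labels H) k| = wcount (runs H) k.
Proof.
move=> iH eH; apply: eq_card => w; rewrite !inE; apply/asboolP/idP.
  move=> [x [i [[e [eD te xe]] wx]]]; have /and3P[sH _ _] := iH.
  apply/exists_inP; exists (source (e i)).
    by have [] := is_subgraphP sH (eD i).
  apply/existsP; exists (source (e (i + k))).
  have -> : w = mkseq (fun j => label (e (i + j))) k :> seq L.
    case: k w wx => [w _|k w wx]; first by rewrite tuple0.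
    apply: (@eq_from_nth _ (tnth w ord0)) => [|j].
      by rewrite size_mkseq size_tuple.
    rewrite size_tuple => jk; rewrite nth_mkseq // -xe.
    by have /= <- := wx (Ordinal jk); rewrite [RHS](tnth_nth (tnth w ord0)).
  exact: path_run.
move=> /exists_inP[v vH /existsP[u r]].
have [x xu] := infinite_path iH eH (run_in iH vH r).
have [z [zv zw _]] := labels_from_cat r xu.
exists z, 0; split; first exact: labels_fromE zv.
by move=> j; rewrite (tnth_nth (z j)) -zw nth_mkseq // size_tuple.
Qed.

End InfinitePaths.

Lemma path_labels_relabel (L L' : finType) (f : L -> L') (G : lgraph L)
    (H : subgraph G) :
  path_labels (G := relabel f G) H = (fun x k => f (x k)) @` path_labels H.
Proof.
apply/seteqP; split => [y [e [eD te ye]]|_ [x [e [eD te xe]] <-]].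
  exists (fun k => @label _ G (e k)); first by exists e.
  by apply/funext => k; rewrite ye.
by exists e; split => // k; rewrite xe.
Qed.

(** * Exponential growth rates *)

Lemma runs_submul (L : finType) (G : lgraph L) (H : subgraph G) i j :
  irreducible H ->
  wcount (runs H) (i + j) <= wcount (runs H) i * wcount (runs H) j.
Proof.
move=> iH; apply: wcount_cat => w sw /exists_inP[v vH /existsP[u]].
rewrite -{1}(cat_take_drop i w) => /run_cat[x r1 r2]; split.
  by apply/exists_inP; exists v => //; apply/existsP; exists x.
apply/exists_inP; exists x; first exact: run_in r1.
by apply/existsP; exists u.
Qed.

Local Open Scope classical_set_scope.
Local Open Scope ring_scope.

Section Growth.
Variable R : realType.
Implicit Types (u v : nat -> nat) (r : R).

Definition grows u r := exists C : R, forall k, (u k)%:R <= C * r ^+ k.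

Lemma grows_ge0 u r : grows u r -> 0 < r ->
  exists2 C : R, 0 < C & forall k, (u k)%:R <= C * r ^+ k.
Proof.
move=> [C uC] r0; exists (Num.max C 1); first by rewrite lt_max ltr01 orbT.
move=> k; apply: le_trans (uC k) _; apply: ler_wpM2r; first by rewrite exprn_ge0 ?ltW.
by rewrite le_max lexx.
Qed.

Lemma grows_le u v r : (forall k, (u k <= v k)%N) -> grows v r -> grows u r.
Proof.
by move=> uv [C vC]; exists C => k; apply: le_trans (vC k); rewrite ler_nat.
Qed.

Lemma grows_rate u r r' : 0 < r -> r <= r' -> grows u r -> grows u r'.
Proof.
move=> r0 rr' /grows_ge0 /(_ r0) [C C0 uC]; exists C => k.
apply: le_trans (uC k) _; rewrite ler_pM2l //.
by apply: lerXn2r => //; rewrite nnegrE ltW // (lt_le_trans r0).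
Qed.

Lemma growsD u v r : grows u r -> grows v r -> grows (fun k => u k + v k)%N r.
Proof.
by move=> [C uC] [C' vC]; exists (C + C') => k; rewrite natrD mulrDl lerD.
Qed.

Lemma grows0 r : grows (fun=> 0%N) r.
Proof. by exists 0 => k; rewrite mul0r. Qed.

Lemma grows_sum (I : finType) (u : I -> nat -> nat) r :
  (forall i, grows (u i) r) -> grows (fun k => \sum_i u i k)%N r.
Proof.
move=> /choice[C uC]; exists (\sum_i C i) => k.
by rewrite natr_sum mulr_suml; apply: ler_sum.
Qed.

(** Convolving with a sequence of strictly smaller rate does not increase the
    rate, since the geometric series of the quotients converges. *)
Lemma grows_conv u v r1 r : 0 < r1 -> r1 < r -> grows u r1 -> grows v r ->
  grows (fun k => \sum_(j < k) u j * v (k - j.+1))%N r.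
Proof.
move=> r10 r1r gu gv; have r0 := lt_trans r10 r1r.
have [C C0 uC] := grows_ge0 gu r10; have [C' C'0 vC] := grows_ge0 gv r0.
have rr1 : 0 < r - r1 by rewrite subr_gt0.
exists (C * C' / (r - r1)) => k.
apply: (@le_trans _ _ (C * C' * \sum_(j < k) r ^+ (k.-1 - j) * r1 ^+ j)).
  rewrite natr_sum mulr_sumr; apply: ler_sum => j _; rewrite natrM.
  have -> : (k.-1 - j = k - j.+1)%N by lia.
  rewrite [r ^+ _ * _]mulrC mulrACA; apply: ler_pM => //; exact: ler0n.
have -> : \sum_(j < k) r ^+ (k.-1 - j) * r1 ^+ j = (r ^+ k - r1 ^+ k) / (r - r1).
  rewrite subrXX mulrAC divff ?gt_eqF // mul1r; apply: eq_bigr => j _.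
  by congr (r ^+ _ * _).
rewrite mulrA mulrAC ler_pM2l ?divr_gt0 ?mulr_gt0 // gerBl.
by rewrite exprn_ge0 // ltW.
Qed.

End Growth.

(** Once a path has left the component of [v], strictly fewer vertices are
    reachable. So, by induction on that number, the words read from [v] are
    counted by the words of one component plus convolutions of that count with
    counts already known to have rate [r]. *)
Lemma grows_runs_from (R : realType) (L : finType) (G : lgraph L) (r1 r : R)
    (v : vertex G) : 0 < r1 -> r1 < r ->
  (forall u, reaches v u -> grows (wcount (runs (scc_graph u))) r1) ->
  grows (wcount (runs_from [set: edge G]%SET v)) r.
Proof.
move=> r10 r1r; have [N] := ubnP #|[pred u | reaches v u]|.
elim: N v => // N IH v cv gv.
have gs := gv v (connect0 _ _).
pose leaves (e : edge G) := (source e \in scc v) && (target e \notin scc v).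
pose W := wcount (runs (scc_graph v)).
pose F (e : edge G) := if leaves e then
  wcount (runs_from [set: edge G]%SET (target e)) else fun=> 0%N.
have gF e : grows (F e) r.
  rewrite /F; case: ifP => [/andP[se te]|_]; last exact: grows0.
  have vs : reaches v (source e) by move: se; rewrite inE => /andP[].
  have vt : reaches v (target e) by apply: connect_trans vs (edge_reaches e).
  apply: IH => [|u tu]; last by apply: gv; apply: connect_trans vt tu.
  rewrite ltnS in cv; apply: leq_trans cv; apply: proper_card.
  apply/fintype.properP; split.
    by apply/fintype.subsetP => u; rewrite !inE; exact: connect_trans.
  exists v; rewrite !inE; first exact: connect0.
  by apply: contra te => tv; rewrite inE vt.
pose u k := (W k + \sum_e \sum_(j < k) W j * F e (k - j.+1))%N.
have gu : grows u r.
  apply: growsD; first exact: (grows_rate r10 (ltW r1r) gs).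
  by apply: grows_sum => e; exact: (grows_conv r10 r1r gs (gF e)).
apply: grows_le gu => k.
pose Q (p : edge G * 'I_k) (w : seq L) := [&& leaves p.1,
  runs (scc_graph v) (take p.2 w), nth (label p.1) w p.2 == label p.1 &
  runs_from [set: edge G]%SET (target p.1) (drop p.2.+1 w)].
apply: (@leq_trans (wcount (fun w => runs (scc_graph v) w || [exists p, Q p w]) k)).
  apply: leq_wcount => w sw /existsP[y] /(run_scc_split (scc_refl v))[r'|].
    by apply/orP; left; apply/exists_inP; exists v; rewrite ?scc_refl //; apply/existsP; exists y.
  move=> [j [e [jw le rj ej re]]]; rewrite sw in jw.
  apply/orP; right; apply/existsP; exists (e, Ordinal jw); apply/and4P; split => //=.
  - by apply/exists_inP; exists v; rewrite ?scc_refl //; apply/existsP; exists (source e).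
  - exact/eqP.
  - by apply/existsP; exists y.
apply: leq_trans (wcount_or _ _ _) _; rewrite leq_add2l pair_bigA /=.
apply: (@leq_trans (\sum_p wcount (Q p) k)%N).
  by apply: wcount_cover => w _ /existsP.
apply: leq_sum => -[e j] _ /=; rewrite /F; case: ifP => le.
  by apply: wcount_split (label e) (ltn_ord j) _ => w _ /and4P[_ -> /eqP -> ->].
by rewrite muln0 leqn0; apply/eqP/eq_card0 => w; rewrite !inE /Q /= le.
Qed.


(** * Fekete's lemma *)

Section Fekete.
Variables (R : realType) (a : nat -> R).
Hypotheses (a0 : forall n, 0 <= a n).
Hypothesis aD : forall i j, a (i + j)%N <= a i + a j.

Definition mean_inf : R := inf [set n.+1%:R^-1 * a n.+1 | n in [set: nat]].

Lemma has_lbound_mean : has_lbound [set n.+1%:R^-1 * a n.+1 | n in [set: nat]].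
Proof. by exists 0 => _ [n _ <-]; rewrite mulr_ge0. Qed.

Lemma mean_inf_ge0 : 0 <= mean_inf.
Proof.
apply: lb_le_inf; first by exists (1%:R^-1 * a 1), 0%N.
by move=> _ [n _ <-]; rewrite mulr_ge0.
Qed.

Lemma mean_inf_le n : n%:R * mean_inf <= a n.
Proof.
case: n => [|n]; first by rewrite mul0r.
rewrite -ler_pdivlMl ?ltr0n //; apply: ge_inf; first exact: has_lbound_mean.
by exists n.
Qed.

(** Choose [q] whose mean [a q / q] is within [e] of the infimum and divide
    [n] by [q]: subadditivity bounds [a n] by [n / q] copies of [a q] plus the
    value at a remainder below [q], which is bounded. *)
Lemma le_mean_inf e : 0 < e ->
  exists C, forall n, a n <= n%:R * (mean_inf + e) + C.
Proof.
move=> e0; have [|_ [q _ <-] qe] := inf_adherent e0 (E := [set n.+1%:R^-1 * a n.+1 | n in [set: nat]]).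
  split; [by exists (1%:R^-1 * a 1), 0%N | exact: has_lbound_mean].
rewrite -/mean_inf in qe; exists (\sum_(r < q.+1) a r) => n.
have aM d r : a (d * q.+1 + r)%N <= d%:R * a q.+1 + a r.
  elim: d => [|d IH]; first by rewrite mul0r add0r.
  rewrite mulSn -addnA; apply: le_trans (aD _ _) _.
  by rewrite -natr1 mulrDl mul1r [X in X + a r]addrC -addrA lerD2l.
rewrite {1}(divn_eq n q.+1); apply: le_trans (aM _ _) _; apply: lerD; last first.
  rewrite (bigD1 (Ordinal (ltn_pmod n (ltn0Sn q)))) //= lerDl.
  by apply: sumr_ge0.
move: qe; rewrite ltr_pdivrMl ?ltr0n // => /ltW qe.
apply: le_trans (ler_wpM2l (ler0n _ _) qe) _.
rewrite mulrA; apply: ler_wpM2r; first by rewrite addr_ge0 ?mean_inf_ge0 ?ltW.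
by rewrite -natrM ler_nat leq_divM.
Qed.

Lemma cvg_mean_inf : (fun n => n%:R^-1 * a n) @ \oo --> mean_inf.
Proof.
apply/cvgrPdist_le => e e0.
have [C aC] := le_mean_inf (divr_gt0 e0 (ltr0n R 2)).
near=> n; have n0 : 0 < n%:R :> R.
  by apply: (@lt_le_trans _ _ 1) => //; near: n; exact: nbhs_infty_ger.
have lo : mean_inf <= n%:R^-1 * a n by rewrite ler_pdivlMl // mean_inf_le.
rewrite distrC ger0_norm ?subr_ge0 // lerBlDl.
rewrite ler_pdivrMl //; apply: le_trans (aC n) _.
rewrite !mulrDr -addrA lerD2l -lerBrDl -mulrBr.
have -> : e - e / 2 = e / 2 by rewrite [X in X - _](splitr e) addrK.
rewrite -ler_pdivrMr ?divr_gt0 //; near: n; exact: nbhs_infty_ger.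
Unshelve. all: by end_near. Qed.

End Fekete.

(** * Entropy of an irreducible graph *)

Section EntropyGrowth.
Variables (R : realType) (L : finType).

Lemma entropy_set0 : entropy R (set0 : set (nat -> L)) = 0.
Proof.
rewrite /entropy; apply/cvg_lim => //.
have w0 n : #|words (set0 : set (nat -> L)) n| = 0%N.
  by apply/eq_card0 => w; rewrite inE; apply/asboolP => -[x [i []]].
apply: (@cvg_trans _ (cst (0 : R) @ \oo)); last exact: cvg_cst.
by apply: near_eq_cvg; apply: nearW => n; rewrite w0 ln0 ?mulr0.
Qed.

Variable G : lgraph L.
Implicit Types H : subgraph G.

Let logW H n : R := ln (wcount (runs H) n)%:R.

Lemma path_labels_edgeless H : ~~ has_edges H -> path_labels H = set0.
Proof.
move=> nH; apply/seteqP; split => // x [e [eH _ _]].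
by case/negP: nH; apply/existsP; exists (e 0%N).
Qed.

Section WithEdges.
Variable H : subgraph G.
Hypotheses (iH : irreducible H) (eH : has_edges H).

Lemma wcount_runs_gt0 n : (0 < wcount (runs H) n)%N.
Proof.
have /and3P[_ /existsP[v vH] _] := iH.
have [w sw r] := run_prolong iH eH n vH.
by apply: wcount_gt0 sw _; apply/exists_inP; exists v.
Qed.

Lemma ln_runs_ge0 n : 0 <= logW H n.
Proof. by rewrite ln_ge0 // ler1n wcount_runs_gt0. Qed.

Lemma ln_runs_subadditive i j : logW H (i + j) <= logW H i + logW H j.
Proof.
rewrite /logW -lnM ?posrE ?ltr0n ?wcount_runs_gt0 // -natrM.
rewrite ler_ln ?posrE ?ltr0n ?muln_gt0 ?wcount_runs_gt0 // ler_nat.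
exact: runs_submul.
Qed.

Lemma entropy_mean_inf : entropy R (path_labels H) = mean_inf (logW H).
Proof.
rewrite /entropy; apply/cvg_lim => //.
have -> : (fun n => n%:R^-1 * ln #|words (path_labels H) n|%:R) =
          (fun n => n%:R^-1 * logW H n).
  by apply/funext => n; rewrite card_words.
exact: (cvg_mean_inf ln_runs_ge0 ln_runs_subadditive).
Qed.

Lemma expR_entropy_le n :
  expR (entropy R (path_labels H)) ^+ n <= (wcount (runs H) n)%:R.
Proof.
rewrite -expRM_natl -[leRHS]lnK ?posrE ?ltr0n ?wcount_runs_gt0 // ler_expR.
by rewrite entropy_mean_inf; exact: (mean_inf_le ln_runs_ge0).
Qed.

End WithEdges.

Lemma entropy_ge0 H : irreducible H -> 0 <= entropy R (path_labels H).
Proof.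
move=> iH; have [eH|nH] := boolP (has_edges H).
  by rewrite entropy_mean_inf //; apply/mean_inf_ge0/ln_runs_ge0.
by rewrite path_labels_edgeless // entropy_set0.
Qed.

Lemma grows_runs H c : irreducible H -> entropy R (path_labels H) < c ->
  grows (wcount (runs H)) (expR c).
Proof.
move=> iH hc; have [eH|nH] := boolP (has_edges H); last first.
  exists 1 => k; rewrite mul1r; apply: (@le_trans _ _ 1).
    by rewrite lern1 wcount_runs_edgeless.
  apply: exprn_ege1; rewrite -expR0 ler_expR (le_trans _ (ltW hc)) //.
  exact: entropy_ge0.
rewrite entropy_mean_inf // in hc; rewrite -subr_gt0 in hc.
have [C WC] := le_mean_inf (ln_runs_ge0 iH eH) (ln_runs_subadditive iH eH) hc.
exists (expR C) => k; rewrite -expRM_natl -expRD.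
rewrite -[leLHS]lnK ?posrE ?ltr0n ?wcount_runs_gt0 // ler_expR.
by apply: le_trans (WC k) _; rewrite addrC [_ + (c - _)]addrC subrK.
Qed.

End EntropyGrowth.

Definition runs_to (L : finType) (G : lgraph L) (D : {set edge G}) v w :=
  [exists u, run D u w v].

Lemma wcount_runs_to (L : finType) (G : lgraph L) (D : {set edge G}) v k :
  wcount (runs_from (G := revg G) D v) k = wcount (runs_to D v) k.
Proof.
rewrite -[LHS]wcount_rev; apply: eq_card => w; rewrite !inE.
by apply: eq_existsb => u; rewrite run_revg.
Qed.

Section VertexGrowth.
Variables (R : realType) (L : finType) (G : lgraph L) (v : vertex G).

Lemma grows_from b c : b < c ->
  (forall u, reaches v u -> entropy R (path_labels (scc_graph u)) <= b) ->
  grows (wcount (runs_from [set: edge G]%SET v)) (expR c).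
Proof.
move=> bc hb; have [b1 c1] := midf_lt bc.
(* The midpoint leaves room both above the entropies and below [c]. *)
apply: (@grows_runs_from _ _ _ (expR ((b + c) / 2))).
- exact: expR_gt0.
- by rewrite ltr_expR.
- move=> u /hb ub; apply: grows_runs; first exact: irreducible_scc.
  exact: le_lt_trans ub b1.
Qed.

(** Words read towards [v] are the reversed words read from [v] in the reversed
    graph, whose components carry the same number of words of each length. *)
Lemma grows_to b c : b < c ->
  (forall u, reaches u v -> entropy R (path_labels (scc_graph u)) <= b) ->
  grows (wcount (runs_to [set: edge G]%SET v)) (expR c).
Proof.
move=> bc hb; have [b1 c1] := midf_lt bc.
suff gv : grows (wcount (runs_from (G := revg G) [set: edge G]%SET v)) (expR c).
  by apply: grows_le gv => k; rewrite wcount_runs_to.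
apply: (@grows_runs_from _ _ _ (expR ((b + c) / 2))).
- exact: expR_gt0.
- by rewrite ltr_expR.
- move=> u; rewrite reaches_revg => /hb ub.
  have gu := grows_runs (irreducible_scc (G := G) u) (le_lt_trans ub b1).
  apply: grows_le gu => k; rewrite scc_graph_revg wcount_runs_revg //.
  exact: irreducible_scc.
Qed.

End VertexGrowth.

(** Moving from the words of the whole irreducible graph to those read from a
    single vertex costs a bounded shift of the length and a bounded factor,
    hence only a constant. *)
Lemma runs_from_lower (R : realType) (L : finType) (G : lgraph L)
    (H : subgraph G) (v : vertex G) (r : R) :
  irreducible H -> has_edges H -> v \in H.1 -> 1 <= r ->
  (forall k, r ^+ k <= (wcount (runs H) k)%:R) ->
  exists2 c : R, 0 < c & forall k, c * r ^+ k <= (wcount (runs_from H.2 v) k)%:R.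
Proof.
move=> iH eH vH r1 rW; set N := #|vertex G|; have r0 := lt_le_trans ltr01 r1.
have N0 : 0 < N.+1%:R * r ^+ N by rewrite mulr_gt0 ?exprn_gt0.
exists (N.+1%:R * r ^+ N)^-1; first by rewrite invr_gt0.
move=> k; rewrite ler_pdivrMl //; have [kN|Nk] := ltnP k N.
  have [w sw rw] := run_prolong iH eH k vH.
  apply: (@le_trans _ _ (r ^+ N)); first by apply: ler_weXn2l => //; exact: ltnW.
  rewrite -mulrA mulrCA ler_peMr ?exprn_ge0 ?(ltW r0) // -natrM ler1n muln_gt0 /=.
  exact: wcount_gt0 sw rw.
rewrite -{1}(subnK Nk) exprD mulrAC -natrM ler_pM2r ?exprn_gt0 //.
apply: le_trans (rW _) _; rewrite ler_nat.
by have := wcount_runs_le iH eH (k - N) vH; rewrite -/N subnK.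
Qed.

Section ComponentLower.
Variables (R : realType) (L : finType) (G : lgraph L).
Variables (H : subgraph G) (v : vertex G).
Hypotheses (iH : irreducible H) (eH : has_edges H) (vH : v \in H.1).

Let expR_entropy_ge1 : 1 <= expR (entropy R (path_labels H)).
Proof. by rewrite -expR0 ler_expR; exact: entropy_ge0. Qed.

Lemma entropy_le_from : exists2 c : R, 0 < c & forall k,
  c * expR (entropy R (path_labels H)) ^+ k <= (wcount (runs_from H.2 v) k)%:R.
Proof. by apply: runs_from_lower => // k; exact: expR_entropy_le. Qed.

Lemma entropy_le_to : exists2 c : R, 0 < c & forall k,
  c * expR (entropy R (path_labels H)) ^+ k <= (wcount (runs_to H.2 v) k)%:R.
Proof.
have [|c c0 cW] := runs_from_lower (irreducible_revg iH) eH vH expR_entropy_ge1.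
  by move=> k; rewrite wcount_runs_revg //; exact: expR_entropy_le.
by exists c => // k; rewrite -wcount_runs_to.
Qed.

End ComponentLower.


(** * Expansions in an integer base *)

Fixpoint digits_value (q : nat) (s : seq nat) : nat :=
  if s is a :: s' then (a * q ^ size s' + digits_value q s')%N else 0%N.

Lemma digits_value_lt q s : all (fun a => a < q)%N s ->
  (digits_value q s < q ^ size s)%N.
Proof.
elim: s => //= a s IH /andP[aq /IH vs].
apply: (@leq_trans (a.+1 * q ^ size s)); first by rewrite mulSn addnC ltn_add2r.
by rewrite expnS leq_mul2r aq orbT.
Qed.

Lemma digits_value_inj q s t : size s = size t ->
  all (fun a => a < q)%N s -> all (fun a => a < q)%N t ->
  digits_value q s = digits_value q t -> s = t.
Proof.
elim: s t => [|a s IH] [|b t] //= [st] /andP[_ sq] /andP[_ tq] vE.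
have vs := digits_value_lt sq; have vt := digits_value_lt tq.
rewrite st in vE vs; have q0 : (0 < q ^ size t)%N by apply: leq_ltn_trans vt.
have ab : a = b.
  by have := congr1 (fun z => z %/ q ^ size t)%N vE; rewrite !divnMDl // !divn_small ?addn0.
by rewrite ab in vE *; rewrite (IH t) //; move/addnI: vE.
Qed.

Lemma mkseq_cat (T : Type) (f : nat -> T) i j :
  mkseq f (i + j) = mkseq f i ++ mkseq (fun k => f (i + k)%N) j.
Proof.
rewrite /mkseq iotaD map_cat add0n; congr (_ ++ _).
by rewrite -[X in iota X _]addn0 iotaDl -map_comp.
Qed.

Section Expansion.
Variables (R : realType) (q : nat).
Hypothesis q0 : (0 < q)%N.

(** For [x = 0] this is the finite expansion with digits [s]. *)
Definition horner_digits (x : R) (s : seq nat) : R :=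
  foldr (fun a y => (y + a%:R) / q%:R) x s.

Let qX i : 0 < q%:R ^+ i :> R.
Proof. by rewrite exprn_gt0 ?ltr0n. Qed.

Lemma horner_digitsE x s :
  horner_digits x s = ((digits_value q s)%:R + x) / q%:R ^+ size s.
Proof.
elim: s => [|a s IH]; first by rewrite /= add0r expr0 divr1.
rewrite /= -/(horner_digits x s) IH natrD natrM natrX exprSr invfM mulrA.
by congr (_ / _); rewrite -addrA [RHS]mulrDl mulfK ?gt_eqF // [LHS]addrC.
Qed.

Variable a : nat -> nat.
Hypothesis aq : forall k, (a k < q)%N.

Let all_digits (b : nat -> nat) i : (forall k, (b k < q)%N) ->
  all (fun c => c < q)%N (mkseq b i).
Proof. by move=> bq; apply/allP => c /mapP[k _ ->]. Qed.

Lemma horner_digits01 b i : (forall k, (b k < q)%N) ->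
  0 <= horner_digits 0 (mkseq b i) <= 1.
Proof.
move=> bq; rewrite horner_digitsE addr0; apply/andP; split.
  by rewrite divr_ge0 ?ler0n // ltW.
rewrite ler_pdivrMr // mul1r.
by rewrite -natrX ler_nat ltnW // digits_value_lt // all_digits.
Qed.

(** The digits after position [i] contribute between 0 and 1, in units of
    [q ^- i]. *)
Lemma horner_digits_bounds i j : (i <= j)%N ->
  (digits_value q (mkseq a i))%:R <= horner_digits 0 (mkseq a j) * q%:R ^+ i
    <= (digits_value q (mkseq a i))%:R + 1.
Proof.
move=> /subnKC <-; rewrite mkseq_cat /horner_digits foldr_cat.
rewrite -![foldr _ _ _]/(horner_digits _ _) horner_digitsE size_mkseq divfK ?gt_eqF //.
by rewrite lerDl lerD2l horner_digits01.
Qed.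

Lemma cvg_horner_digits : cvgn (fun k => horner_digits 0 (mkseq a k)).
Proof.
apply: nondecreasing_is_cvgn.
  move=> i j ij; have /andP[+ _] := horner_digits_bounds ij.
  by rewrite [horner_digits 0 (mkseq a i)]horner_digitsE addr0 size_mkseq ler_pdivrMr.
by exists 1 => _ [k _ <-]; have /andP[] := horner_digits01 k aq.
Qed.

Lemma lim_horner_digits_bounds i :
  (digits_value q (mkseq a i))%:R <= limn (fun k => horner_digits 0 (mkseq a k)) * q%:R ^+ i
    <= (digits_value q (mkseq a i))%:R + 1.
Proof.
apply/andP; split.
  rewrite -ler_pdivrMr //; apply: limr_ge; first exact: cvg_horner_digits.
  near=> k; rewrite ler_pdivrMr //; have ik : (i <= k)%N by near: k; exact: nbhs_infty_ge.
  by have /andP[] := horner_digits_bounds ik.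
rewrite -ler_pdivlMr //; apply: limr_le; first exact: cvg_horner_digits.
near=> k; rewrite ler_pdivlMr //; have ik : (i <= k)%N by near: k; exact: nbhs_infty_ge.
by have /andP[] := horner_digits_bounds ik.
Unshelve. all: by end_near. Qed.

End Expansion.

(** * Approximate squares *)

Section Cells.
Variables (R : realType) (m n : nat).
Hypotheses (m0 : (0 < m)%N) (n0 : (0 < n)%N).
Implicit Types (x : nat -> digit m n) (X : set (nat -> digit m n)).

Definition row_digits x k : nat := (x k).1.
Definition col_digits x k : nat := (x k).2.

Lemma coding_lim x : coding R x =
  (limn (fun k => horner_digits m (0 : R) (mkseq (row_digits x) k)),
   limn (fun k => horner_digits n (0 : R) (mkseq (col_digits x) k))).
Proof.
have foldE (s : seq (digit m n)) : foldr (@S_map R m n) (0, 0) s =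
   (horner_digits m (0 : R) [seq (d.1 : nat) | d : digit m n <- s], horner_digits n (0 : R) [seq (d.2 : nat) | d : digit m n <- s]).
  by elim: s => //= d s ->.
rewrite /coding.
have -> : (fun k => foldr (@S_map R m n) (0, 0) (mkseq x k)) =
  (fun k => (horner_digits m (0 : R) (mkseq (row_digits x) k),
             horner_digits n (0 : R) (mkseq (col_digits x) k))).
  by apply/funext => k; rewrite foldE /mkseq -!map_comp.
apply: (@cvg_lim (R * R)%type); first exact: (@norm_hausdorff R (R * R)%type).
have c1 : cvgn (fun k => horner_digits m (0 : R) (mkseq (row_digits x) k)).
  by apply: cvg_horner_digits => // k; exact: ltn_ord.
have c2 : cvgn (fun k => horner_digits n (0 : R) (mkseq (col_digits x) k)).
  by apply: cvg_horner_digits => // k; exact: ltn_ord.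
exact: cvg_pair c1 c2.
Qed.

(** The rectangles of width [m ^ - l] and height [n ^ - k] are indexed by [l]
    row digits and [k] column digits. *)
Definition cell l k x : l.-tuple 'I_m * k.-tuple 'I_n :=
  ([tuple of mkseq (fun i => (x i).1) l], [tuple of mkseq (fun i => (x i).2) k]).

Definition cells l k X : {set l.-tuple 'I_m * k.-tuple 'I_n} :=
  [set c | `[< exists2 x, X x & cell l k x = c >]]%SET.

Definition cell_index l k (c : l.-tuple 'I_m * k.-tuple 'I_n) : nat * nat :=
  (digits_value m (map (@nat_of_ord m) c.1), digits_value n (map (@nat_of_ord n) c.2)).

Lemma cell_index_inj l k : injective (@cell_index l k).
Proof.
have ordall N (s : seq 'I_N) : all (fun a => a < N)%N (map (@nat_of_ord N) s).
  by apply/allP => a /mapP[i _ ->]; exact: ltn_ord.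
move=> [c1 c2] [d1 d2] [e1 e2]; congr (_, _); apply: val_inj => /=.
- apply: (inj_map val_inj); apply: digits_value_inj e1 => //.
  by rewrite !size_map !size_tuple.
- apply: (inj_map val_inj); apply: digits_value_inj e2 => //.
  by rewrite !size_map !size_tuple.
Qed.

Lemma coding_cell l k x : let c := cell_index (cell l k x) in
  [/\ c.1%:R <= (coding R x).1 * m%:R ^+ l <= c.1%:R + 1 &
      c.2%:R <= (coding R x).2 * n%:R ^+ k <= c.2%:R + 1].
Proof.
rewrite coding_lim /cell_index /= /mkseq -!map_comp; split.
- by apply: (@lim_horner_digits_bounds R m m0 (row_digits x)) => i; exact: ltn_ord.
- by apply: (@lim_horner_digits_bounds R n n0 (col_digits x)) => i; exact: ltn_ord.
Qed.

Lemma diam_square (x0 y0 s d : R) : 0 <= s -> 0 <= d -> s ^+ 2 + s ^+ 2 = d ^+ 2 ->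
  diam [set p : R * R | x0 <= p.1 <= x0 + s /\ y0 <= p.2 <= y0 + s] = d%:E.
Proof.
move=> s0 d0 sd; have sqd : Num.sqrt (d ^+ 2) = d by rewrite sqrtr_sqr ger0_norm.
apply/eqP; rewrite eq_le; apply/andP; split.
  apply: ge_ereal_sup => _ [p [p1 p2] [p' [p'1 p'2] <-]]; rewrite lee_fin /euclid_dist.
  rewrite -sqd ler_sqrt ?sqr_ge0 // -sd.
  have sq (u v z : R) : z <= u <= z + s -> z <= v <= z + s -> (u - v) ^+ 2 <= s ^+ 2.
    move=> /andP[zu us] /andP[zv vs]; rewrite -[leLHS]real_normK ?num_real //.
    rewrite lerXn2r ?nnegrE //.
    by rewrite ler_norml lerBrDl lerBlDl; apply/andP; split; lra.
  by apply: lerD; [exact: sq p1 p'1 | exact: sq p2 p'2].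
apply: ereal_sup_ubound; exists (x0 + s, y0 + s); first by rewrite /= !lexx !lerDl s0.
exists (x0, y0); first by rewrite /= !lexx !lerDl s0.
by rewrite /euclid_dist /= ![_ + s]addrC !addrK sd sqd.
Qed.

(** A cell is enlarged to a square of side [s] because covering sets must have
    diameter exactly [d]. *)
Lemma coverable_cells X l k (d s : R) : 0 <= d -> 0 <= s ->
  s ^+ 2 + s ^+ 2 = d ^+ 2 -> m%:R ^- l <= s -> n%:R ^- k <= s ->
  coverable (coding R @` X) d #|cells l k X|.
Proof.
move=> d0 s0 sd ml nk.
have ml0 : 0 < m%:R ^+ l :> R by rewrite exprn_gt0 ?ltr0n.
have nk0 : 0 < n%:R ^+ k :> R by rewrite exprn_gt0 ?ltr0n.
pose lo (c : l.-tuple 'I_m * k.-tuple 'I_n) : R * R :=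
  ((cell_index c).1%:R / m%:R ^+ l, (cell_index c).2%:R / n%:R ^+ k).
exists (fun i => let c := enum_val i in
  [set p : R * R | (lo c).1 <= p.1 <= (lo c).1 + s /\ (lo c).2 <= p.2 <= (lo c).2 + s]).
split; first by move=> i; exact: diam_square.
move=> _ [x Xx <-]; have cx : cell l k x \in cells l k X.
  by rewrite inE; apply/asboolP; exists x.
exists (enum_rank_in cx (cell l k x)) => //=; rewrite enum_rankK_in //.
have [/andP[a1 a2] /andP[b1 b2]] := coding_cell l k x.
rewrite /lo /=; split; apply/andP; split.
- by rewrite ler_pdivrMr.
- apply: (@le_trans _ _ (((cell_index (cell l k x)).1%:R + 1) / m%:R ^+ l)).
    by rewrite ler_pdivlMr.
  by rewrite mulrDl mul1r lerD2l.
- by rewrite ler_pdivrMr.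
- apply: (@le_trans _ _ (((cell_index (cell l k x)).2%:R + 1) / n%:R ^+ k)).
    by rewrite ler_pdivlMr.
  by rewrite mulrDl mul1r lerD2l.
Qed.

Lemma diam_dist (U : set (R * R)) (d : R) p p' : diam U = d%:E -> U p -> U p' ->
  `|p.1 - p'.1| <= d /\ `|p.2 - p'.2| <= d.
Proof.
move=> Ud Up Up'; have : ((euclid_dist p p')%:E <= diam U)%E.
  by apply: ereal_sup_ubound; exists p => //; exists p'.
rewrite Ud lee_fin => pd; split; apply: le_trans pd; rewrite /euclid_dist -sqrtr_sqr.
- by rewrite ler_sqrt ?lerDl ?sqr_ge0 // addr_ge0 ?sqr_ge0.
- by rewrite ler_sqrt ?lerDr ?sqr_ge0 // addr_ge0 ?sqr_ge0.
Qed.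

(** The bound is two and not one because a point may lie on the common border
    of two cells and be coded in either. *)
Lemma index_close (u v M d : R) (i j : nat) : 0 < M -> `|u - v| <= d -> d * M <= 1 ->
  i%:R <= u * M <= i%:R + 1 -> j%:R <= v * M <= j%:R + 1 -> (i <= j + 2)%N.
Proof.
move=> M0 uv dM /andP[i1 i2] /andP[j1 j2].
have : (u - v) * M <= 1.
  apply: le_trans dM; rewrite ler_pM2r //; apply: le_trans uv; exact: ler_norm.
rewrite mulrBl => uvM; rewrite -(ler_nat R) natrD; lra.
Qed.

(** A set of diameter at most the grid steps sees, in each coordinate, indices
    within two of a fixed one: five rows and five columns. *)
Lemma card_cells_le X l k (d : R) N : d * m%:R ^+ l <= 1 -> d * n%:R ^+ k <= 1 ->
  coverable (coding R @` X) d N -> (#|cells l k X| <= 25 * N)%N.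
Proof.
move=> dl dk [U [Ud XU]].
have ml0 : 0 < m%:R ^+ l :> R by rewrite exprn_gt0 ?ltr0n.
have nk0 : 0 < n%:R ^+ k :> R by rewrite exprn_gt0 ?ltr0n.
pose Q (i : 'I_N) (c : l.-tuple 'I_m * k.-tuple 'I_n) :=
  `[< exists2 x, cell l k x = c & U i (coding R x) >].
apply: (@leq_trans (\sum_i #|Q i|)).
  apply: leq_card_cover => c; rewrite -[pred_of_set _ c]/(c \in cells l k X) inE.
  move=> /asboolP[x Xx xc].
  have [i _ Ui] := XU (coding R x) (ex_intro2 _ _ x Xx erefl).
  by exists i; apply/asboolP; exists x.
rewrite mulnC -[X in (_ <= X * _)%N]card_ord -sum_nat_const; apply: leq_sum => i _.
have [c0 Qc0|Q0] := pickP (Q i); last by rewrite eq_card0.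
have [x0 x0c Ux0] := asboolP _ Qc0.
have QP c : Q i c -> [/\ ((cell_index c).1 <= (cell_index c0).1 + 2)%N,
    ((cell_index c0).1 <= (cell_index c).1 + 2)%N,
    ((cell_index c).2 <= (cell_index c0).2 + 2)%N &
    ((cell_index c0).2 <= (cell_index c).2 + 2)%N].
  move=> /asboolP[x xc Ux].
  have [h1 h2] := diam_dist (Ud i) Ux Ux0; have [h1' h2'] := diam_dist (Ud i) Ux0 Ux.
  have [a1 a2] := coding_cell l k x; have [b1 b2] := coding_cell l k x0.
  rewrite xc in a1 a2; rewrite x0c in b1 b2.
  split.
  - exact: index_close h1 dl a1 b1.
  - exact: index_close h1' dl b1 a1.
  - exact: index_close h2 dk a2 b2.
  - exact: index_close h2' dk b2 a2.
pose J (c : l.-tuple 'I_m * k.-tuple 'I_n) : 'I_5 * 'I_5 :=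
  (inord ((cell_index c).1 + 2 - (cell_index c0).1),
   inord ((cell_index c).2 + 2 - (cell_index c0).2)).
have <- : #|{: 'I_5 * 'I_5}| = 25%N by rewrite card_prod !card_ord.
apply: (leq_card_inj (f := J)) => // c c' /QP[c1 c2 c3 c4] /QP[c1' c2' c3' c4'].
move=> [/(congr1 (@nat_of_ord 5)) e1 /(congr1 (@nat_of_ord 5)) e2].
apply: cell_index_inj; rewrite [LHS]surjective_pairing [RHS]surjective_pairing.
rewrite /cell_index /= in c1 c2 c3 c4 c1' c2' c3' c4' e1 e2 *.
by congr (_, _); [move: e1 | move: e2]; rewrite !inordK; lia.
Qed.

End Cells.


(** * From cell counts to box dimension *)

Lemma limf_esup_cvg (R : realType) (F : set_system R) (f : R -> R) (d : R) :
  ProperFilter F -> (forall e, 0 < e -> \forall x \near F, `|f x - d| <= e) ->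
  limf_esup (fun x => (f x)%:E) F = d%:E.
Proof.
move=> PF fd; rewrite limf_esupE; apply/eqP; rewrite eq_le; apply/andP; split.
  apply/lee_addgt0Pr => e e0; have Fe := fd e e0.
  apply: (@le_trans _ _ (ereal_sup [set (f x)%:E | x in [set x | `|f x - d| <= e]])).
    by apply: ereal_inf_lbound; exists [set x | `|f x - d| <= e].
  apply: ge_ereal_sup => _ [x /= fx <-]; rewrite lee_fin.
  by move: fx; rewrite ler_norml => /andP[]; lra.
apply/lee_addgt0Pr => e e0; rewrite -leeBlDr //; apply: le_ereal_inf_tmp => _ [V FV <-].
have [x [Vx fx]] := filter_ex (filterI FV (fd e e0)).
apply: (@le_trans _ _ (f x)%:E); last by apply: ereal_sup_ubound; exists x.
by rewrite -EFinB lee_fin; move: fx; rewrite ler_norml => /andP[]; lra.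
Qed.

Section BoxDim.
Variables (R : realType).

Lemma has_box_dim_near (E : set (R * R)) (d : R) :
  (forall e, 0 < e -> \forall delta \near 0^'+,
     `|ln (covering_number E delta)%:R / - ln delta - d| <= e) ->
  has_box_dim E d.
Proof.
move=> Ed; split; last exact: limf_esup_cvg.
rewrite /lower_box_dim /limf_einf.
rewrite (_ : (\- box_ratio E)%E = fun x => (- (ln (covering_number E x)%:R / - ln x))%:E).
  rewrite (@limf_esup_cvg _ _ _ (- d)) ?EFinN ?oppeK // => e /Ed; apply: filterS => x.
  by rewrite -opprD normrN.
by apply/funext => x; rewrite /box_ratio -EFinN.
Qed.

Lemma covering_numberP (E : set (R * R)) (delta : R) k : coverable E delta k ->
  coverable E delta (covering_number E delta) /\ (covering_number E delta <= k)%N.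
Proof.
move=> Ek; rewrite /covering_number.
set Q := [set j | _]; have [j [Ej jmin]] : exists j, Q j.
  have ex : exists j, `[< coverable E delta j >] by exists k; apply/asboolP.
  case: (ex_minnP ex) => j /asboolP Ej jmin; exists j; split => // i /asboolP.
  exact: jmin.
have [Ex xmin] : Q (xget 0%N Q) by apply: xgetPex; exists j; split.
by split => //; exact: xmin.
Qed.

Lemma near_neg_ln (M : R) : \forall delta \near 0^'+, M <= - ln delta.
Proof.
near=> x; have x0 : 0 < x by near: x; exact: nbhs_right_gt.
rewrite lerNr -ler_expR lnK ?posrE //; apply: ltW; near: x.
by apply: nbhs_right_lt; exact: expR_gt0.
Unshelve. all: by end_near. Qed.

Variables (m n : nat) (X : set (nat -> digit m n)).
Hypotheses (hm : (2 <= m)%N) (hmn : (m < n)%N).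

(** Cells of height [n ^ - k] are approximate squares when their width is the
    least negative power of [m] that is not smaller than that height. *)
Definition row_depth k := trunc_log m (n ^ k).

Definition square_count k : nat := #|cells (row_depth k) k X|.

Let m0 : (0 < m)%N. Proof. exact: ltnW. Qed.
Let n0 : (0 < n)%N. Proof. exact: leq_trans m0 (ltnW hmn). Qed.
Let n1 : (1 < n)%N. Proof. exact: leq_trans hm (ltnW hmn). Qed.
Let mX l : 0 < m%:R ^+ l :> R. Proof. by rewrite exprn_gt0 ?ltr0n. Qed.
Let nX l : 0 < n%:R ^+ l :> R. Proof. by rewrite exprn_gt0 ?ltr0n. Qed.

Lemma row_depth_le k : m%:R ^+ row_depth k <= n%:R ^+ k :> R.
Proof. by rewrite -!natrX ler_nat trunc_logP // expn_gt0 n0. Qed.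

Lemma row_depth_gt k : n%:R ^+ k < m%:R ^+ (row_depth k).+1 :> R.
Proof. by rewrite -!natrX ltr_nat trunc_log_ltn. Qed.

Lemma leq_row_depth k : (k <= row_depth k)%N.
Proof.
have := @trunc_log_max m (n ^ k) k hm; apply.
by case: k => // k; rewrite leq_exp2r // ltnW.
Qed.

(** A cell of height [n ^ -(k + 3)] has width less than [m * n ^ -(k + 3)],
    which is at most [delta / n] and so at most the side [delta / sqrt 2]. *)
Lemma covering_le delta k : 0 < delta -> 1 <= delta * n%:R ^+ k.+1 ->
  coverable (coding R @` X) delta (square_count (k + 3)).
Proof.
move=> d0 dk; have s2 : 0 < Num.sqrt (2 : R) by rewrite sqrtr_gt0.
have s2E : Num.sqrt (2 : R) ^+ 2 = 2 by rewrite sqr_sqrtr.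
have n2 : 2 <= n%:R :> R by rewrite ler_nat.
have hs : delta <= n%:R * (delta / Num.sqrt 2).
  rewrite mulrCA; apply: ler_peMr; first exact: ltW.
  rewrite ler_pdivlMr // mul1r.
  apply: le_trans n2; nra.
have hk : n%:R ^- k.+1 <= delta by rewrite -div1r ler_pdivrMr.
apply: (@coverable_cells _ _ _ m0 n0 _ _ _ _ (delta / Num.sqrt 2)).
- exact: ltW.
- by rewrite divr_ge0 ?ltW.
- by rewrite expr_div_n s2E; field.
- rewrite -div1r ler_pdivrMr //.
  have := row_depth_gt (k + 3); rewrite addn3 exprS [_ ^+ (row_depth _).+1]exprS exprS.
  move=> h.
  have h1 : n%:R * (n%:R * n%:R ^+ k.+1) <= n%:R * m%:R ^+ row_depth k.+3 :> R.
    by apply: le_trans (ltW h) _; rewrite ler_pM2r // ler_nat ltnW.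
  rewrite ler_pM2l ?ltr0n // in h1.
  have h2 : delta * (n%:R * n%:R ^+ k.+1) <= n%:R * (delta / Num.sqrt 2) * m%:R ^+ row_depth k.+3.
    by apply: ler_pM => //; apply: ltW => //; rewrite mulr_gt0 // ltr0n.
  have h3 : n%:R <= delta * (n%:R * n%:R ^+ k.+1) by rewrite mulrCA; apply: ler_peMr.
  have := le_trans h3 h2; rewrite -mulrA -[leLHS]mulr1 ler_pM2l ?ltr0n //.
- rewrite -div1r ler_pdivrMr // addn3 exprS exprS mulrCA mulrA.
  apply: le_trans dk _; apply: ler_pM => //; try exact: ltW.
  by apply: ler_peMl; [exact: ltW | rewrite ler1n].
Qed.

Lemma square_count_le (delta : R) k N : delta * n%:R ^+ k <= 1 -> 0 <= delta ->
  coverable (coding R @` X) delta N -> (square_count k <= 25 * N)%N.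
Proof.
move=> dk d0; apply: card_cells_le => //; apply: le_trans dk.
by rewrite ler_wpM2l // row_depth_le.
Qed.

Lemma scale_exists (delta : R) : 0 < delta -> delta < 1 ->
  exists k, delta * n%:R ^+ k < 1 /\ 1 <= delta * n%:R ^+ k.+1.
Proof.
move=> d0 d1; have ex : exists k, 1 <= delta * n%:R ^+ k.
  exists (Num.truncn delta^-1).+1; rewrite -ler_pdivrMl // mulr1.
  apply: le_trans (ltW (truncnS_gt _)) _.
  by rewrite -natrX ler_nat ltnW // ltn_expl.
case: (ex_minnP ex) => -[|k]; first by rewrite expr0 mulr1 leNgt d1.
move=> dk kmin; exists k; split => //; rewrite ltNge; apply/negP => /kmin.
by rewrite ltnn.
Qed.

(** A scale [delta] lies between two consecutive powers of [1 / n], and there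
    the covering number is squeezed between [square_count k / 25] and
    [square_count (k + 3)]. Constants and bounded shifts of [k] vanish in the
    ratio of logarithms since [- ln delta] tends to infinity. *)
Lemma has_box_dim_square_count d : 0 <= d ->
  (exists2 c : R, 0 < c &
     forall k, c * expR (k%:R * (d * ln n%:R)) <= (square_count k)%:R) ->
  (forall e, 0 < e -> exists C : R,
     forall k, (square_count k)%:R <= C * expR (k%:R * (d * ln n%:R + e))) ->
  has_box_dim (coding R @` X) d.
Proof.
move=> d0 [c c0 lo] up; apply: has_box_dim_near => e e0.
have lnn : 0 < ln n%:R :> R by rewrite ln_gt0 // ltr1n.
have e'0 : 0 < e * ln n%:R / 2 by rewrite divr_gt0 ?mulr_gt0.
have [C upC] := up _ e'0; set e' := e * ln n%:R / 2 in e'0 upC; set D := d * ln n%:R in lo upC.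
have D0 : 0 <= D by rewrite mulr_ge0 // ltW.
have P0 k : 0 < (square_count k)%:R :> R.
  by apply: lt_le_trans (lo k); rewrite mulr_gt0 ?expR_gt0.
have C0 : 0 < C.
  have := lt_le_trans (P0 0%N) (upC 0%N); rewrite pmulr_lgt0 //; exact: expR_gt0.
near=> x.
have x0 : 0 < x by near: x; exact: nbhs_right_gt.
have x1 : x < 1 by near: x; exact: nbhs_right_lt.
have L1 : 1 <= - ln x by near: x; exact: near_neg_ln.
have Lup : (ln C + 3 * (D + e')) / (e / 2) <= - ln x by near: x; exact: near_neg_ln.
have Llo : (ln 25 + D - ln c) / e <= - ln x by near: x; exact: near_neg_ln.
set L := - ln x in L1 Lup Llo *; have L0 : 0 < L by apply: lt_le_trans L1.
have [k [xk xk1]] := scale_exists x0 x1.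
have kL : k%:R * ln n%:R <= L.
  move: (ltW xk); rewrite -ler_ln ?posrE ?mulr_gt0 // ln1 lnM ?posrE // lnXn ?ltr0n //.
  by rewrite -[ln _ *+ _]mulr_natl /L; lra.
have Lk : L <= (k%:R + 1) * ln n%:R.
  move: xk1; rewrite -ler_ln ?posrE ?mulr_gt0 // ln1 lnM ?posrE // lnXn ?ltr0n //.
  by rewrite -[ln _ *+ _]mulr_natl -natr1 /L; lra.
have [cov Nup] := covering_numberP (covering_le x0 xk1).
have Nlo := square_count_le (ltW xk) (ltW x0) cov.
set N := covering_number _ _ in cov Nup Nlo *.
have N0 : 0 < N%:R :> R.
  rewrite ltr0n lt0n; apply: contraTneq (P0 k) => NE.
  by rewrite NE muln0 leqn0 in Nlo; rewrite (eqP Nlo) ltxx.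
have lnup : ln N%:R <= ln C + (k%:R + 3) * (D + e').
  have h : N%:R <= C * expR ((k + 3)%:R * (D + e')).
    by apply: le_trans (upC _); rewrite ler_nat.
  have : ln N%:R <= ln (C * expR ((k + 3)%:R * (D + e'))).
    by rewrite ler_ln ?posrE // mulr_gt0 ?expR_gt0.
  by rewrite lnM ?posrE ?expR_gt0 // expRK natrD.
have lnlo : ln c + k%:R * D <= ln 25 + ln N%:R.
  have h : c * expR (k%:R * D) <= 25 * N%:R.
    by apply: le_trans (lo k) _; rewrite -natrM ler_nat.
  have : ln (c * expR (k%:R * D)) <= ln (25 * N%:R).
    by rewrite ler_ln ?posrE // mulr_gt0 ?expR_gt0.
  by rewrite !lnM ?posrE ?expR_gt0 // expRK.
rewrite ler_norml; apply/andP; split.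
  rewrite lerBrDl ler_pdivlMr //.
  rewrite ler_pdivrMr // in Llo.
  have : d * L <= k%:R * D + D.
    have := ler_wpM2l d0 Lk; rewrite /D; lra.
  by lra.
rewrite lerBlDl ler_pdivrMr //.
have e2 : 0 < e / 2 by rewrite divr_gt0.
rewrite ler_pdivrMr // in Lup.
have : k%:R * (D + e') <= (d + e / 2) * L.
  have de : 0 <= d + e / 2 by rewrite addr_ge0 // ltW.
  have := ler_wpM2l de kL; rewrite /D /e'; lra.
by lra.
Unshelve. all: by end_near. Qed.

End BoxDim.


(** * Counting approximate squares by paths *)

Section SquareCount.
Variables (m n : nat) (G : lgraph (digit m n)).
Hypotheses (hm : (2 <= m)%N) (hmn : (m < n)%N).

Definition row_graph : lgraph 'I_m := relabel (fun d : digit m n => d.1) G.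

(** The first [k] digits of a coded point and its next row digits are read along
    a path into, respectively out of, the vertex [v] visited at time [k]. *)
Lemma square_count_le_paths k :
  (square_count (path_labels (whole G)) k <=
   \sum_v wcount (runs_to [set: edge G]%SET v) k *
          wcount (runs_from (G := row_graph) [set: edge G]%SET v) (row_depth m n k - k))%N.
Proof.
have kl := leq_row_depth hm hmn k; set l := row_depth m n k in kl *.
pose f (c : l.-tuple 'I_m * k.-tuple 'I_n) : k.-tuple (digit m n) * (l - k).-tuple 'I_m :=
  ([tuple of zip (wtake kl c.1) c.2], [tuple of drop k c.1]).
pose Q (v : vertex G) c := runs_to [set: edge G]%SET v (f c).1 &&
  runs_from (G := row_graph) [set: edge G]%SET v (f c).2.
apply: (@leq_trans (\sum_v #|Q v|)).
  apply: leq_card_cover => c; rewrite -[pred_of_set _ c]/(c \in cells l k _) inE.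
  move=> /asboolP[x [e [_ te xe]] <-].
  exists (source (e k)); rewrite /Q /f /=; apply/andP; split.
    apply/existsP; exists (source (e 0%N)).
    have := path_run (D := [set: edge G]%SET) 0 k (fun i => finset.in_setT _) te.
    congr run; rewrite wtakeE /=; apply: (@eq_from_nth _ (x 0%N)).
      by rewrite size_zip size_takel !size_mkseq ?minnn.
    move=> i; rewrite size_mkseq => ik.
    rewrite nth_mkseq // [x 0%N]surjective_pairing nth_zip; last first.
      by rewrite size_takel !size_mkseq.
    rewrite nth_take // !nth_mkseq ?(leq_trans ik) //.
    by rewrite -surjective_pairing xe.
  apply/existsP; exists (source (e l)).
  have := path_run (D := [set: edge G]%SET) k (l - k) (fun i => finset.in_setT _) te.
  rewrite subnKC // => /(run_relabel (fun d : digit m n => d.1)).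
  congr (run (G := row_graph)); apply: (@eq_from_nth _ (x 0%N).1).
    by rewrite size_map size_drop !size_mkseq.
  move=> i; rewrite size_map size_mkseq => ik.
  rewrite (nth_map (x 0%N)) ?size_mkseq // nth_mkseq // nth_drop nth_mkseq ?xe //.
  by lia.
apply: leq_sum => v _; rewrite /wcount -cardX.
apply: (leq_card_inj (f := f)) => [c c' _ _|c]; last by rewrite inE.
move=> ff; have /= z := congr1 (fun p => val p.1) ff.
have /= d := congr1 (fun p => val p.2) ff.
have s1 (b : l.-tuple 'I_m * k.-tuple 'I_n) : size (wtake kl b.1) = size b.2.
  by rewrite !size_tuple.
have := congr1 (@unzip1 _ _) z; rewrite !unzip1_zip ?s1 // !wtakeE => t.
have := congr1 (@unzip2 _ _) z; rewrite !unzip2_zip ?s1 // => e2.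
case: c c' t e2 d {z ff} => [c1 c2] [c1' c2'] /= t e2 d; congr (_, _); apply: val_inj => //=.
by rewrite -(cat_take_drop k c1) -(cat_take_drop k c1') t d.
Qed.

(** Conversely a word read into [v], a fixed transit word from [v] to [u] of
    length [t], and a row word read from [u] and prolonged for ever, together
    make a point of the coded set from whose cell both words are recovered. *)
Lemma paths_le_square_count (H K : subgraph G) v u : irreducible K -> has_edges K ->
  u \in K.1 -> reaches v u ->
  exists t, forall k,
    (wcount (runs_to H.2 v) k *
     wcount (runs_from (G := row_graph) K.2 u) (row_depth m n k - k - t) <=
     square_count (path_labels (whole G)) k)%N.
Proof.
move=> iK eK uK vu; have [p rp _] := connect_run vu; pose t := size p; exists t => k.
have kl := leq_row_depth hm hmn k; rewrite /square_count; set l := row_depth m n k in kl *.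
set j := (l - k - t)%N; rewrite /wcount -cardX.
pose good (wy : k.-tuple (digit m n) * j.-tuple 'I_m) x :=
  [/\ path_labels (whole G) x, mkseq x k = wy.1 &
      mkseq (fun i => (x (k + t + i)%N).1) j = wy.2].
have ex (wy : k.-tuple (digit m n) * j.-tuple 'I_m) :
    exists x, runs_to H.2 v wy.1 && runs_from (G := row_graph) K.2 u wy.2 -> good wy x.
  have [/andP[/existsP[s rw] /existsP[z]]|] := boolP (_ && _); last first.
    have [x _] := infinite_path iK eK uK.
    by exists x.
  move=> /(relabel_run (G := G))[w' rw' w'y].
  have zK := run_in iK uK rw'.
  have [x0 x0z] := infinite_path iK eK zK.
  have sT (E : {set edge G}) : E \subset (whole G).2 by exact: finset.subsetT.
  have x0z' := labels_from_sub (sT _) x0z.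
  have [x1 [x1u x1w x1x0]] := labels_from_cat (run_sub (sT _) rw') x0z'.
  have [x2 [x2v x2p x2x1]] := labels_from_cat rp x1u.
  have [x3 [x3s x3w x3x2]] := labels_from_cat (run_sub (sT _) rw) x2v.
  exists x3 => _; split; first exact: labels_fromE x3s.
    by move: x3w; rewrite size_tuple.
  rewrite -w'y -x1w /mkseq -map_comp -(size_map (fun d : digit m n => d.1) w') w'y size_tuple.
  apply: eq_map => i /=; rewrite -addnA -{1}(size_tuple wy.1) x3x2 x2x1 //.
(* [g] picks a coded sequence for each pair; the cell of that sequence
   determines the pair. *)
have [g gP] := choice ex.
apply: (leq_card_inj (f := fun wy => cell l k (g wy))) => [wy wy'|wy].
  rewrite !inE => /gP[_ a1 a2] /gP[_ b1 b2] cc.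
  have /= c1 := congr1 (fun p => val p.1) cc.
  have /= c2 := congr1 (fun p => val p.2) cc.
  have rE i : (i < l)%N -> (g wy i).1 = (g wy' i).1.
    by move=> il; have := congr1 (fun s => nth (g wy i).1 s i) c1; rewrite !nth_mkseq.
  have cE i : (i < k)%N -> (g wy i).2 = (g wy' i).2.
    by move=> il; have := congr1 (fun s => nth (g wy i).2 s i) c2; rewrite !nth_mkseq.
  rewrite [LHS]surjective_pairing [RHS]surjective_pairing.
  congr (_, _); apply: val_inj => /=.
    rewrite -a1 -b1; apply/eq_in_map => i; rewrite mem_iota /= add0n => ik.
    rewrite [LHS]surjective_pairing [RHS]surjective_pairing cE // rE //.
    exact: leq_trans kl.
  rewrite -a2 -b2; apply/eq_in_map => i; rewrite mem_iota /= add0n => ij.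
  by apply: rE; move: ij; rewrite /j; lia.
rewrite inE => /gP[? _ _]; rewrite -[pred_of_set _ _]/(_ \in cells l k _) inE.
by apply/asboolP; exists (g wy).
Qed.

End SquareCount.


(** * The two maxima *)

Section Main.
Variables (R : realType) (m n : nat) (G : lgraph (digit m n)).
Hypotheses (hm : (2 <= m)%N) (hmn : (m < n)%N).
Let Sigma := path_labels (whole G).
Hypothesis S0 : Sigma !=set0.

Let m0 : (0 < m)%N. Proof. exact: ltnW. Qed.
Let n0 : (0 < n)%N. Proof. exact: leq_trans m0 (ltnW hmn). Qed.
Let lnm : R := ln m%:R.
Let lnn : R := ln n%:R.
Let lnm0 : 0 < lnm. Proof. by rewrite ln_gt0 // ltr1n. Qed.
Let lnm_lt : lnm < lnn.
Proof. by rewrite ltr_ln ?posrE ?ltr0n ?ltr_nat. Qed.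
Let lnn0 : 0 < lnn. Proof. exact: lt_trans lnm_lt. Qed.

Let h (H : subgraph G) := entropy R (path_labels H).
Let g (K : subgraph G) := entropy R (path_labels (G := row_graph G) K).
Let rho' := lnm^-1 - lnn^-1.
Let rho'0 : 0 < rho'.
Proof. by rewrite subr_gt0 ltf_pV2 // posrE. Qed.

Let dim := \big[Num.max/0]_(H in components G)
  (h H / lnn + (\big[Num.max/0]_(K in successors H) g K) * rho').

Let h_ge0 H : irreducible H -> 0 <= h H. Proof. exact: entropy_ge0. Qed.
Let g_ge0 (K : subgraph G) : irreducible K -> 0 <= g K.
Proof. exact: (@entropy_ge0 _ _ (row_graph G)). Qed.

Lemma le_dim H K : H \in components G -> K \in successors H ->
  h H / lnn + g K * rho' <= dim.
Proof.
move=> cH sK; apply: le_trans (le_bigmax_cond _ _ cH); rewrite lerD2l.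
by rewrite ler_pM2r //; apply: (le_bigmax_cond _ _ sK).
Qed.

Lemma scc_successor (u1 u2 v : vertex G) : reaches u1 v -> reaches v u2 ->
  scc_graph (G := G) u2 \in successors (scc_graph (G := G) u1).
Proof.
move=> uv vu; rewrite inE scc_component /=; apply/existsP; exists u1.
rewrite scc_refl; apply/existsP; exists u2; rewrite scc_refl /=.
exact: connect_trans uv vu.
Qed.

Lemma row_depth_ln_le k : (row_depth m n k)%:R * lnm <= k%:R * lnn.
Proof.
have := row_depth_le R hm hmn k.
rewrite -ler_ln ?posrE ?exprn_gt0 ?ltr0n // !lnXn ?ltr0n //.
by rewrite -[ln m%:R *+ _]mulr_natl -[ln n%:R *+ _]mulr_natl.
Qed.

Lemma row_depth_ln_gt k : k%:R * lnn <= ((row_depth m n k)%:R + 1) * lnm.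
Proof.
have := ltW (row_depth_gt R n hm k).
rewrite -ler_ln ?posrE ?exprn_gt0 ?ltr0n // !lnXn ?ltr0n //.
by rewrite -[ln m%:R *+ _]mulr_natl -[ln n%:R *+ _]mulr_natl -natr1.
Qed.

Let rho := rho' * lnn.
Let rhoE : rho = lnn / lnm - 1.
Proof. by rewrite /rho mulrBl mulVf ?gt_eqF // mulrC. Qed.
Let rho0 : 0 < rho. Proof. exact: mulr_gt0. Qed.

(** The number of row digits of a cell that have no matching column digit: it
    is [k * rho] up to one unit. *)
Let tail k := (row_depth m n k - k)%N.

Lemma tail_le k : (tail k)%:R <= k%:R * rho.
Proof.
rewrite natrB ?leq_row_depth // rhoE mulrBr mulr1 lerD2r mulrA.
by rewrite ler_pdivlMr // row_depth_ln_le.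
Qed.

Lemma tail_ge k : k%:R * rho - 1 <= (tail k)%:R.
Proof.
rewrite natrB ?leq_row_depth // rhoE mulrBr mulr1 mulrA addrAC lerD2r.
by rewrite lerBlDr ler_pdivrMr // row_depth_ln_gt.
Qed.

(** Around a vertex [v], the best component leading to [v] and the best one
    reached from [v] form a pair that competes in the two maxima. *)
Lemma grows_vertex v e : 0 < e -> exists C : R, forall k,
  (wcount (runs_to [set: edge G]%SET v) k *
   wcount (runs_from (G := row_graph G) [set: edge G]%SET v) (tail k))%:R <=
  C * expR (k%:R * (dim * lnn + e)).
Proof.
move=> e0.
have [u1 u1v u1max] : exists2 u1, reaches u1 v &
    forall u, reaches u v -> h (scc_graph (G := G) u) <= h (scc_graph (G := G) u1).
  have [u1 ? ?] := @arg_maxP _ R _ v (fun u => reaches u v) (fun u => h (scc_graph (G := G) u)) (connect0 _ _).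
  by exists u1.
have [u2 vu2 u2max] : exists2 u2, reaches v u2 &
    forall u, reaches v u -> g (scc_graph (G := G) u) <= g (scc_graph (G := G) u2).
  have [u2 ? ?] := @arg_maxP _ R _ v (fun u => reaches v u) (fun u => g (scc_graph (G := G) u)) (connect0 _ _).
  by exists u2.
have := le_dim (scc_component u1) (scc_successor u1v vu2).
set a := h _ in u1max *; set b := g _ in u2max * => abD.
(* The rates are exceeded over a total length of about [k * (1 + rho)]. *)
have e1 : 0 < e / (1 + rho) by rewrite divr_gt0 // addr_gt0.
set d := e / (1 + rho) in e1.
have gA : grows (wcount (runs_to [set: edge G]%SET v)) (expR (a + d)).
  by apply: (grows_to (b := a)) => //; rewrite ltrDl.
have [C1 C10 A] := grows_ge0 gA (expR_gt0 _).
have gB : grows (wcount (runs_from (G := row_graph G) [set: edge G]%SET v)) (expR (b + d)).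
  by apply: (grows_from (b := b)) => //; rewrite ltrDl.
have [C2 C20 B] := grows_ge0 gB (expR_gt0 _).
exists (C1 * C2).
move=> k; rewrite natrM.
apply: le_trans (ler_pM (ler0n _ _) (ler0n _ _) (A k) (B (tail k))) _.
rewrite mulrACA ler_pM2l ?mulr_gt0 // -!expRM_natl -expRD ler_expR.
have b0 : 0 <= b + d.
  by rewrite addr_ge0 ?(ltW e1) //; apply: g_ge0; exact: irreducible_scc.
apply: (@le_trans _ _ (k%:R * (a + d) + k%:R * rho * (b + d))).
  by rewrite lerD2l ler_wpM2r // tail_le.
rewrite -mulrA -mulrDr; apply: ler_wpM2l => //.
have -> : a + d + rho * (b + d) = (a / lnn + b * rho') * lnn + d * (1 + rho).
  rewrite mulrDl divfK ?gt_eqF // -mulrA -/rho; ring.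
rewrite /d divfK ?gt_eqF ?addr_gt0 // lerD2r ler_pM2r //.
Qed.

Lemma square_count_upper e : 0 < e -> exists C : R, forall k,
  (square_count Sigma k)%:R <= C * expR (k%:R * (dim * lnn + e)).
Proof.
move=> e0; have /choice[C CP] v : exists C : R, forall k,
    (wcount (runs_to [set: edge G]%SET v) k *
     wcount (runs_from (G := row_graph G) [set: edge G]%SET v) (tail k))%:R <=
    C * expR (k%:R * (dim * lnn + e)) by exact: grows_vertex.
exists (\sum_v C v) => k.
apply: (@le_trans _ _ (\sum_v (wcount (runs_to [set: edge G]%SET v) k *
    wcount (runs_from (G := row_graph G) [set: edge G]%SET v) (tail k))%:R)).
  by rewrite -natr_sum ler_nat; exact: square_count_le_paths.
by rewrite mulr_suml; apply: ler_sum => v _; exact: CP.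
Qed.

(** The lower half of the dimension formula for the exponent [z]; it is
    stable under maxima, so that it can be proved pair by pair. *)
Definition squares_grow z := exists2 c : R, 0 < c &
  forall k, c * expR (k%:R * (z * lnn)) <= (square_count Sigma k)%:R.

Lemma squares_grow_le y z : y <= z -> squares_grow z -> squares_grow y.
Proof.
move=> yz [c c0 cP]; exists c => // k; apply: le_trans (cP k).
by rewrite ler_pM2l // ler_expR ler_wpM2l // ler_pM2r.
Qed.

Lemma squares_grow0 : squares_grow 0.
Proof.
exists 1 => // k; rewrite mul0r mulr0 expR0 mul1r ler1n.
have [x Sx] := S0; apply/card_gt0P; exists (cell _ k x).
by rewrite inE; apply/asboolP; exists x.
Qed.

Lemma squares_grow_edges (H K : subgraph G) : H \in components G ->
  K \in successors H -> has_edges H -> has_edges K ->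
  squares_grow (h H / lnn + g K * rho').
Proof.
move=> cH; rewrite inE => /andP[cK /existsP[v /andP[vH /existsP[u /andP[uK vu]]]]] eH eK.
have iH := component_irreducible cH; have iK := component_irreducible cK.
have [t tP] := paths_le_square_count hm hmn H iK eK uK vu.
have [c1 c10 A] := entropy_le_to R iH eH vH.
have [c2 c20 B] := @entropy_le_from R _ (row_graph G) K u iK eK uK.
have g0 : 0 <= g K by exact: g_ge0.
exists (c1 * c2 * expR (- ((1 + t%:R) * g K))); first by rewrite !mulr_gt0 ?expR_gt0.
move=> k; have := tP k; rewrite -(ler_nat R) natrM; apply: le_trans.
apply: le_trans (ler_pM _ _ (A k) (B _)); last 2 first.
- by rewrite mulr_ge0 ?exprn_ge0 ?expR_ge0 ?ltW.
- by rewrite mulr_ge0 ?exprn_ge0 ?expR_ge0 ?ltW.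
rewrite [leRHS]mulrACA -mulrA ler_pM2l ?mulr_gt0 // -!expRM_natl -!expRD ler_expR.
have -> : (h H / lnn + g K * rho') * lnn = h H + g K * rho.
  by rewrite mulrDl divfK ?gt_eqF // -mulrA.
have := tail_ge k; rewrite /tail => tk.
have tkt : (row_depth m n k - k)%:R - t%:R <= (row_depth m n k - k - t)%:R :> R.
  by rewrite lerBlDr -natrD ler_nat addnC -leq_subLR.
have := ler_wpM2r g0 (le_trans (lerB tk (lexx t%:R)) tkt).
rewrite -/(h H) -/(g K); lra.
Qed.

Lemma component_successor H : H \in components G -> H \in successors H.
Proof.
move=> cH; have [v vH] := component_ne cH; rewrite inE cH /=.
by apply/existsP; exists v; rewrite vH; apply/existsP; exists v; rewrite vH connect0.
Qed.

(** A component without edges has entropy 0. So a pair with one such component is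
    dominated by the other component paired with itself, and a pair of two such
    components contributes 0. *)
Lemma squares_grow_pair (H K : subgraph G) : H \in components G ->
  K \in successors H -> squares_grow (h H / lnn + g K * rho').
Proof.
move=> cH sK; have cK : K \in components G by move: sK; rewrite inE => /andP[].
have hn (H' : subgraph G) : ~~ has_edges H' -> h H' = 0.
  by move=> nH; rewrite /h path_labels_edgeless // entropy_set0.
have gn (H' : subgraph G) : ~~ has_edges H' -> g H' = 0.
  move=> nH; rewrite /g (path_labels_edgeless (G := row_graph G)) //.
  exact: entropy_set0.
have h0 (H' : subgraph G) : H' \in components G -> 0 <= h H' / lnn.
  by move=> /component_irreducible /h_ge0 ?; rewrite divr_ge0 // ltW.
have g0 (H' : subgraph G) : H' \in components G -> 0 <= g H' * rho'.
  by move=> /component_irreducible /g_ge0 ?; rewrite mulr_ge0 // ltW.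
have [eH|nH] := boolP (has_edges H); have [eK|nK] := boolP (has_edges K).
- exact: squares_grow_edges.
- apply: squares_grow_le (squares_grow_edges cH (component_successor cH) eH eH).
  by rewrite (gn K nK) mul0r lerD2l g0.
- apply: squares_grow_le (squares_grow_edges cK (component_successor cK) eK eK).
  by rewrite (hn H nH) mul0r lerD2r h0.
- by rewrite hn // gn // !mul0r addr0; exact: squares_grow0.
Qed.

Lemma squares_grow_dim : squares_grow dim.
Proof.
have maxP (P : R -> Prop) x y : P x -> P y -> P (Num.max x y).
  by rewrite /Num.max; case: ifP.
apply: (big_ind squares_grow) => [||H cH]; [exact: squares_grow0 | exact: maxP |].
apply: (big_ind (fun y => squares_grow (h H / lnn + y * rho'))) => [|y z|K sK].
- apply: squares_grow_le (squares_grow_pair cH (component_successor cH)).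
  rewrite mul0r lerD2l mulr_ge0 ?(ltW rho'0) //.
  by apply: g_ge0; exact: component_irreducible.
- exact: (maxP (fun y => squares_grow (h H / lnn + y * rho'))).
- exact: squares_grow_pair.
Qed.

Lemma has_box_dim_path_labels : has_box_dim (coding R @` Sigma) dim.
Proof.
apply: (has_box_dim_square_count hm hmn).
- exact: bigmax_ge_id.
- exact: squares_grow_dim.
- exact: square_count_upper.
Qed.

End Main.

Theorem theorem1p2 (R : realType) (m n : nat) (hm : (2 <= m)%N) (hmn : (m < n)%N)
  (Sigma : set (nat -> digit m n)) (hS : subshift Sigma) (hS0 : Sigma !=set0)
  (G : lgraph (digit m n)) (hG : presents G Sigma) :
  has_box_dim (coding R @` Sigma)
    (\big[Num.max/0]_(H in components G)
       (entropy R (path_labels H) / ln n%:R +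
        (\big[Num.max/0]_(K in successors H)
           entropy R (@row_seq m n @` path_labels K)) *
        ((ln m%:R)^-1 - (ln n%:R)^-1))).
Proof.
rewrite hG in hS0 *; have := has_box_dim_path_labels R hm hmn hS0.
congr has_box_dim; apply: eq_bigr => H _; congr (_ + _ * _).
by apply: eq_bigr => K _; rewrite path_labels_relabel.
Qed.
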